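(* Let $A$ be an apartment of $\mathcal I$. Then the topology on $A$ induced by $\mathscr T_+$ is the affine topology on $A$ (the topology of its structure of finite-dimensional real affine space).
   Context: **Vectorial data.** $I$ is a finite set and $C=(c_{i,j})_{i,j\in I}$ is a Kac--Moody matrix: $c_{i,j}\in\mathbb Z$, $c_{i,i}=2$, $c_{i,j}\le 0$ for $i\neq j$, and $c_{i,j}=0\iff c_{j,i}=0$. $X,Y$ are dual free $\mathbb Z$-modules of finite rank with $\mathbb Z$-linearly independent families $(\alpha_i)_{i\in I}$ in $X$ and $(\alpha_i^\vee)_{i\in I}$ in $Y$ such that $\alpha_j(\alpha_i^\vee)=c_{i,j}$. $\mathbb A=Y\otimes\mathbb R$, with its usual topology; elements of $X$ are linear forms on $\mathbb A$. $r_i(v)=v-\alpha_i(v)\alpha_i^\vee$, and $W^v=\langle r_i\mid i\in I\rangle\subset \mathrm{GL}(\mathbb A)$ (Weyl group), acting on $\mathbb A^*$ by $(w.\alpha)(x)=\alpha(w^{-1}x)$. $\Phi=\{w.\alpha_i\}$ is the set of real roots; for $\alpha=w.\alpha_i\in\Phi$, $\alpha^\vee=w.\alpha_i^\vee$. $Q^\vee=\bigoplus_i\mathbb Z\alpha_i^\vee$ and $W^a=Q^\vee\rtimes W^v$. $\Delta\subset\bigoplus_i\mathbb Z\alpha_i\subset\mathbb A^*$ is the set of all (real and imaginary) roots of the Kac--Moody algebra of $C$. For $\alpha\in\mathbb A^*$, $k\in\mathbb R$: $D(\alpha,k)=\{\alpha(x)+k\ge0\}$, $D^\circ(\alpha,k)=\{\alpha(x)+k>0\}$,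 $M(\alpha,k)=\{\alpha(x)+k=0\}$, and $D(\alpha,+\infty)=D^\circ(\alpha,+\infty)=\mathbb A$. Walls (resp. half-apartments) are the $M(\alpha,k)$ (resp. $D(\alpha,k)$), $\alpha\in\Phi$, $k\in\mathbb Z$. $C^v_f=\{v\mid\alpha_i(v)>0\ \forall i\}$; for $J\subset I$, $F^v(J)=\{v\mid \alpha_i(v)=0\ (i\in J),\ \alpha_i(v)>0\ (i\notin J)\}$. Positive (resp. negative) vectorial faces are the $w.F^v(J)$ (resp. $-w.F^v(J)$), $w\in W^v$; vectorial chambers are the $\pm w.C^v_f$. Tits cone: $\mathcal T=\bigcup_{w}w.\overline{C^v_f}$. A vectorial face is spherical if it meets $\pm\mathring{\mathcal T}$. $x\le y$ means $y-x\in\mathcal T$. A ray or segment through $x\ne y$ from $x$ is preordered if $x\le y$ or $y\le x$, generic if $y-x\in\pm\mathring{\mathcal T}$. **Filters.** A filter lies in a set $Z$ if $Z$ is an element of it; a set (e.g. an apartment) contains a filter if it contains an element of it; a map fixes a filter if it fixes pointwise some element of it. The support of a filter is the smallest affine subspace containing it. $\mathcal F\Cup\mathcal F'=\{E\cup E'\mid E\in\mathcal F,E'\in\mathcal F'\}$. The enclosure $\mathrm{cl}(\mathcal F)$ of a filter on $\mathbb A$ is the filter of sets $E$ containing some $\bigcap_{\alpha\in\Delta}D(\alpha,k_\alpha)\in\mathcal F$ with $k_\alpha\in\mathbb Z\cup\{+\infty\}$ (a set is treated as its principal filter). A sector-face is $f=x+F^v$ ($F^v$ a vectorial face); its germ at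 infinity is the filter of sets containing $x+u+F^v$ for some $u\in\overline{F^v}$. If $F^v$ is a vectorial chamber, $f$ is a sector and its germ is a sector-germ, with the sign of $F^v$; $\pm\infty$ is the germ of $\pm C^v_f$. The face $F(x,F^v)$ is the filter of sets $E$ for which there are $k_\alpha,k'_\alpha\in\mathbb Z\cup\{+\infty\}$ $(\alpha\in\Delta)$ and a neighbourhood $\Omega$ of $x$ with $E\supset\bigcap_{\alpha}(D(\alpha,k_\alpha)\cap D^\circ(\alpha,k'_\alpha))\supset\Omega\cap(x+F^v)$. A chamber (resp. panel) is a face with support $\mathbb A$ (resp. a wall). A chimney is $\mathfrak r(F,F^v)=\mathrm{cl}(F+F^v)$, $F$ a face, $F^v$ a vectorial face; it is splayed if $F^v$ is spherical, solid if the pointwise stabilizer in $W^v$ of the direction of its support is finite. Its germ is the filter of sets belonging to some $\mathfrak r(F+u,F^v)$, $u\in\overline{F^v}$. **Apartments.** $\mathrm{Aut}(\mathbb A)$ is the group of affine bijections of $\mathbb A$ stabilizing $\{(M(\alpha,k),\alpha^\vee)\mid\alpha\in\Phi,k\in\mathbb Z\}$. An apartment of type $\mathbb A$ is a set $A$ with a nonempty set $\mathrm{Isom}^w(\mathbb A,A)$ of bijections $\mathbb A\to A$ forming one orbit $f_0\circ W^a$. A bijection $\phi:A\to A'$ is a Weyl isomorphism (resp. an isomorphism, which here always means vectorially Weyl isomorphism) if $f'^{-1}\circ\phi\circ f\in W^a$ (resp. $\in(W^v\ltimes\mathbb A)\cap\mathrm{Aut}(\mathbb A)$) for $f\in\mathrm{Isom}^w(\mathbb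 A,A)$, $f'\in\mathrm{Isom}^w(\mathbb A,A')$. All above notions, the affine structure and the affine topology are transported to every apartment. **Masure.** A masure of type $\mathbb A$ is a set $\mathcal I$ covered by a family of subsets called apartments such that: (MA1) each apartment has a structure of apartment of type $\mathbb A$. (MA2) If $F$ is a point, a germ of a preordered interval, a generic ray or a solid chimney in an apartment $A$, and $A'$ is another apartment containing $F$, then $A\cap A'$ contains $\mathrm{cl}_A(F)$ and there is a Weyl isomorphism $A\to A'$ fixing $\mathrm{cl}_A(F)$. (MA3) If $\mathfrak R$ is the germ of a splayed chimney and $F$ is a face or a germ of a solid chimney, some apartment contains $\mathfrak R$ and $F$. (MA4) If apartments $A,A'$ contain $\mathfrak R$ and $F$ as in (MA3), there is a Weyl isomorphism $A\to A'$ fixing $\mathrm{cl}_A(\mathfrak R\Cup F)$. (MAO) If $x,y\in A\cap A'$ and $x\le_A y$ then $[x,y]_A=[x,y]_{A'}$. Standing assumptions: $\mathcal I$ is such a masure; each panel lies in the closure of finitely many, and more than $2$, chambers; a group $G$ acts strongly transitively on $\mathcal I$ (it permutes apartments, each $g:A\to g.A$ is an isomorphism of apartments, and all isomorphisms in the axioms are induced by elements of $G$); $\mathbb A$ is identified with a fixed apartment of $\mathcal I$, and the stabilizer of $\mathbb A$ in $G$ induces on $\mathbb A$ the group $W^v\ltimes Y$. $\mathcal I$ is a building if and only if $W^v$ is finite. Sector-germs of $\mathcal I$ are sector-germs of its apartments (a sector-germ contained in an apartment $B$ is a sector-germ of $B$, of the same sign). **Distances.** Let $\mathfrak s$ be a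 sector-germ of sign $\mathrm{sgn}(\mathfrak s)\in\{+,-\}$, $x\in\mathcal I$, $u\in\overline{C^v_f}$. Choose an apartment $A_1$ containing $x$ and $\mathfrak s$ and an isomorphism $\psi:\mathbb A\to A_1$ with $\psi(\mathrm{sgn}(\mathfrak s)\infty)=\mathfrak s$; then $x+_{\mathfrak s}u:=\psi(\psi^{-1}(x)+\mathrm{sgn}(\mathfrak s)u)$ is independent of choices. $U_{\mathfrak s}(x,x')=\{(u,u')\in\overline{C^v_f}^2\mid x+_{\mathfrak s}u=x'+_{\mathfrak s}u'\}$, which is nonempty. $\Theta_+$ (resp. $\Theta_-$) is the set of pairs $\theta=(|\cdot|,\mathfrak s)$ with $|\cdot|$ a norm on $\mathbb A$ and $\mathfrak s$ a positive (resp. negative) sector-germ of $\mathcal I$. For such $\theta$, $d_\theta(x,x')=\inf\{|u|+|u'|\mid(u,u')\in U_{\mathfrak s}(x,x')\}$ is a distance on $\mathcal I$. All $d_\theta$ with $\theta\in\Theta_+$ are equivalent (bounded above and below by positive multiples of one another); $\mathscr T_+$ is the topology on $\mathcal I$ induced by $d_\theta$ for any $\theta\in\Theta_+$. *)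

(* Defs.v *)
From HB Require Import structures.
From mathcomp Require Import all_boot all_order all_algebra.
From mathcomp Require Import all_classical all_reals all_analysis complex.

Set Implicit Arguments.
Unset Strict Implicit.
Unset Printing Implicit Defensive.

Import Order.TTheory GRing.Theory Num.Theory.
Import numFieldNormedType.Exports.
Local Open Scope classical_set_scope.
Local Open Scope ring_scope.

Definition lin_indep (K : pzRingType) (V : lmodType K) (I : finType)
    (v : I -> V) : Prop :=
  forall a : I -> K, \sum_i a i *: v i = 0 -> forall i, a i = 0.

(* Linear forms are row vectors, vectors are column vectors. *)
Definition ev (K : pzRingType) (n : nat) (a : 'rV[K]_n) (x : 'cV[K]_n) : K :=
  (a *m x) 0 0.

Record kac_moody_matrix (I : finType) (c : I -> I -> int) : Prop := {
  kmm_diag : forall i, c i i = 2;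
  kmm_off : forall i j, i != j -> c i j <= 0;
  kmm_zero : forall i j, c i j = 0 <-> c j i = 0 }.

(* A basis of Y and the dual basis of X are fixed, so that Y = 'cV[int]_n and
   X = 'rV[int]_n with the duality pairing [ev]. *)
Record root_datum := RootDatum {
  rd_idx : finType;
  rd_cartan : rd_idx -> rd_idx -> int;
  rd_rank : nat;
  rd_root : rd_idx -> 'rV[int]_rd_rank;
  rd_coroot : rd_idx -> 'cV[int]_rd_rank;
  rd_kac_moody : kac_moody_matrix rd_cartan;
  rd_root_free : lin_indep rd_root;
  rd_coroot_free : lin_indep rd_coroot;
  rd_pairing : forall i j, ev (rd_root j) (rd_coroot i) = rd_cartan i j }.

Definition is_subspace (K : pzRingType) (V : lmodType K) (S : set V) : Prop :=
  S 0 /\ forall a x y, S x -> S y -> S (a *: x + y).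

(* The Kac--Moody algebra g(c) over K, given by its characterization in Kac,
   Infinite dimensional Lie algebras, Prop. 1.4: a Lie algebra containing the
   Cartan subalgebra h of a (minimal) realization of c, generated by h and the
   Chevalley generators e_i, f_i subject to the usual relations, and without
   nonzero ideal meeting h trivially.  It is unique up to isomorphism; h is
   identified with K^m and [km_h] is its embedding. *)
Record km_algebra (K : fieldType) (I : finType) (c : I -> I -> int) :=
  KMAlgebra {
  km_dim : nat;
  km_simple_root : I -> 'rV[K]_km_dim;
  km_simple_coroot : I -> 'cV[K]_km_dim;
  km_root_free : lin_indep km_simple_root;
  km_coroot_free : lin_indep km_simple_coroot;
  km_pairing : forall i j,
    ev (km_simple_root j) (km_simple_coroot i) = (c i j)%:~R;
  km_minimal : (km_dim + \rank (\matrix_(i < #|I|, j < #|I|)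
      ((c (enum_val i) (enum_val j))%:~R : K)) = #|I|.*2)%N;
  km_sort :> lmodType K;
  km_bracket : km_sort -> km_sort -> km_sort;
  km_bracket_linear_l : forall z, linear (km_bracket ^~ z);
  km_bracket_linear_r : forall z, linear (km_bracket z);
  km_bracket_alt : forall x, km_bracket x x = 0;
  km_jacobi : forall x y z,
    km_bracket x (km_bracket y z) + km_bracket y (km_bracket z x)
      + km_bracket z (km_bracket x y) = 0;
  km_h : 'cV[K]_km_dim -> km_sort;
  km_h_linear : linear km_h;
  km_h_inj : injective km_h;
  km_e : I -> km_sort;
  km_f : I -> km_sort;
  km_hh : forall a b, km_bracket (km_h a) (km_h b) = 0;
  km_he : forall a i,
    km_bracket (km_h a) (km_e i) = ev (km_simple_root i) a *: km_e i;
  km_hf : forall a i,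
    km_bracket (km_h a) (km_f i) = - ev (km_simple_root i) a *: km_f i;
  km_ef : forall i j,
    km_bracket (km_e i) (km_f j) =
      if i == j then km_h (km_simple_coroot i) else 0;
  km_generated : forall S : set km_sort, is_subspace S ->
    (forall x y, S x -> S y -> S (km_bracket x y)) ->
    (forall a, S (km_h a)) -> (forall i, S (km_e i)) ->
    (forall i, S (km_f i)) -> S = setT;
  km_no_ideal : forall J : set km_sort, is_subspace J ->
    (forall x y, J y -> J (km_bracket x y)) ->
    (forall a, J (km_h a) -> a = 0) -> J = [set 0] }.

(* beta : I -> int stands for \sum_i beta_i alpha_i in the root lattice. *)
Definition km_is_root (K : fieldType) (I : finType) (c : I -> I -> int)
    (g : km_algebra K c) (beta : I -> int) : Prop :=
  (exists i, beta i != 0) /\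
  exists2 x : g, x != 0 &
    forall a : 'cV[K]_(km_dim g), km_bracket (km_h a) x =
      ev (\sum_i (beta i)%:~R *: km_simple_root g i) a *: x.

Section Model.
Context (R : realType) (D : root_datum) (g : km_algebra R[i] (@rd_cartan D)).

Let I := rd_idx D.
Definition model := 'cV[R]_(rd_rank D).
Definition form := 'rV[R]_(rd_rank D).

Definition sroot (i : I) : form := map_mx intr (rd_root i).
Definition scoroot (i : I) : model := map_mx intr (rd_coroot i).

(* v |-> v - alpha_i(v) alpha_i^vee *)
Definition refl (i : I) : 'M[R]_(rd_rank D) := 1%:M - scoroot i *m sroot i.

(* The r_i are involutions, so the group they generate consists of the words
   in them. *)
Definition weyl : set 'M[R]_(rd_rank D) :=
  [set w | exists s : seq I, w = foldr (fun i m => refl i *m m) 1%:M s].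

(* (w.alpha)(x) = alpha(w^-1 x) *)
Definition real_root : set form :=
  [set a | exists w i, weyl w /\ a = sroot i *m invmx w].

Definition all_root : set form :=
  [set a | exists2 beta : I -> int,
     km_is_root g beta & a = \sum_i (beta i)%:~R *: sroot i].

Definition coroot_lattice : set model :=
  [set v | exists a : I -> int, v = \sum_i (a i)%:~R *: scoroot i].
Definition Y_lattice : set model :=
  [set v | exists y : 'cV[int]_(rd_rank D), v = map_mx intr y].

Definition aff (w : 'M[R]_(rd_rank D)) (v : model) : model -> model :=
  fun x => w *m x + v.

(* W^v semidirect the translations in L *)
Definition weyl_ltimes (L : set model) : set (model -> model) :=
  [set h | exists w v, [/\ weyl w, L v & h = aff w v]].
Definition affine_weyl := weyl_ltimes coroot_lattice.

(* [None] is +oo *)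
Definition hspace (a : form) (k : option int) : set model :=
  if k is Some k then [set x | 0 <= ev a x + k%:~R] else setT.
Definition ohspace (a : form) (k : option int) : set model :=
  if k is Some k then [set x | 0 < ev a x + k%:~R] else setT.
Definition wall (a : form) (k : int) : set model :=
  [set x | ev a x + k%:~R = 0].

(* the pairs (M(alpha, k), alpha^vee), for alpha = w.alpha_i and k in Z *)
Definition wall_coroot : set (set model * model) :=
  [set p | exists w i (k : int), weyl w /\
     p = (wall (sroot i *m invmx w) k, w *m scoroot i)].

Definition model_aut : set (model -> model) :=
  [set h | exists m v, [/\ m \in unitmx, h = aff m v &
     [set (h @` p.1, m *m p.2) | p in wall_coroot] = wall_coroot]].

Definition vw_aut : set (model -> model) := weyl_ltimes setT `&` model_aut.

(* Signs are booleans: [false] is + and [true] is -. *)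
Definition sgn (e : bool) (v : model) : model := (-1) ^+ e *: v.

Definition fund_chamber : set model := [set v | forall i, 0 < ev (sroot i) v].
Definition fund_face (J : {set I}) : set model :=
  [set v | forall i, if i \in J then ev (sroot i) v = 0
                     else 0 < ev (sroot i) v].
Definition vface_sgn (e : bool) (F : set model) : Prop :=
  exists w J, weyl w /\ F = [set sgn e (w *m v) | v in fund_face J].
Definition vface (F : set model) : Prop := exists e, vface_sgn e F.
Definition vchamber (e : bool) (F : set model) : Prop :=
  exists2 w, weyl w & F = [set sgn e (w *m v) | v in fund_chamber].

Definition tits_cone : set model :=
  [set v | exists w v0,
     [/\ weyl w, closure fund_chamber v0 & v = w *m v0]].
Definition pm_tits_interior : set model :=
  [set v | tits_cone° v \/ tits_cone° (- v)].
Definition spherical (F : set model) : Prop := F `&` pm_tits_interior !=set0.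
Definition tits_le (x y : model) : Prop := tits_cone (y - x).

Definition segment (x y : model) : set model :=
  [set x + t *: (y - x) | t in `[0, 1]].
Definition ray (x y : model) : set model :=
  [set x + t *: (y - x) | t in `[0, +oo[].

Definition translate (u : model) (S : set model) : set model :=
  [set u + v | v in S].

Definition affine_subspace (S : set model) : Prop :=
  exists (a : model) (V : {vspace model}), S = [set x | x - a \in V].
Definition support (F : set_system model) : set model :=
  \bigcap_(S in [set S | affine_subspace S /\ F S]) S.
Definition direction (S : set model) : set model :=
  [set v | exists x y, [/\ S x, S y & v = y - x]].

Definition cl (F : set_system model) : set_system model :=
  [set E | exists k : form -> option int,
     let Z := \bigcap_(a in all_root) hspace a (k a) in F Z /\ Z `<=` E].

Definition germ_infty (x : model) (Fv : set model) : set_system model :=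
  [set E | exists2 u, closure Fv u & translate (x + u) Fv `<=` E].

Definition sector_germ_model (e : bool) (s : set_system model) : Prop :=
  exists x Fv, vchamber e Fv /\ s = germ_infty x Fv.
Definition pm_infty (e : bool) : set_system model :=
  germ_infty 0 [set sgn e v | v in fund_chamber].

Definition face_at (x : model) (Fv : set model) : set_system model :=
  [set E | exists (k k' : form -> option int) (Om : set model),
     let Z := \bigcap_(a in all_root) (hspace a (k a) `&` ohspace a (k' a)) in
     [/\ nbhs x Om, Om `&` translate x Fv `<=` Z & Z `<=` E]].
Definition face (F : set_system model) : Prop :=
  exists x Fv, vface Fv /\ F = face_at x Fv.
Definition chamber (F : set_system model) : Prop :=
  face F /\ support F = setT.
Definition panel (F : set_system model) : Prop :=
  face F /\ exists a (k : int), real_root a /\ support F = wall a k.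

Definition filter_plus (F : set_system model) (S : set model) :
    set_system model :=
  [set E | exists2 E', F E' & [set x + v | x in E' & v in S] `<=` E].
Definition chimney (F : set_system model) (Fv : set model) :
    set_system model := cl (filter_plus F Fv).
Definition chimney_germ (F : set_system model) (Fv : set model) :
    set_system model :=
  [set E | exists2 u, closure Fv u & chimney (filter_plus F [set u]) Fv E].
Definition solid (C : set_system model) : Prop :=
  finite_set [set w | weyl w /\
    forall v, direction (support C) v -> w *m v = v].

Definition solid_chimney (C : set_system model) : Prop :=
  exists F Fv, [/\ face F, vface Fv, C = chimney F Fv & solid C].
Definition solid_chimney_germ (C : set_system model) : Prop :=
  exists F Fv,
    [/\ face F, vface Fv, C = chimney_germ F Fv & solid (chimney F Fv)].
Definition splayed_chimney_germ (C : set_system model) : Prop :=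
  exists F Fv, [/\ face F, vface Fv, C = chimney_germ F Fv & spherical Fv].

(* The intervals with origin x are [x, y] and ]x, y]; their germ at x is the
   trace of the neighbourhood filter of x. *)
Definition preordered_interval_germ (F : set_system model) : Prop :=
  exists x y, [/\ x != y, tits_le x y \/ tits_le y x &
    F = within (segment x y) (nbhs x) \/
    F = within (segment x y `\ x) (nbhs x)].
Definition generic_ray (F : set_system model) : Prop :=
  exists x y, [/\ x != y, pm_tits_interior (y - x) & F = globally (ray x y)].
Definition point (F : set_system model) : Prop :=
  exists x, F = globally [set x].

Definition ma2_filter (F : set_system model) : Prop :=
  [\/ point F, preordered_interval_germ F, generic_ray F | solid_chimney F].

Record is_norm (N : model -> R) : Prop := {
  norm_triangle : forall x y, N (x + y) <= N x + N y;
  norm_scale : forall (a : R) x, N (a *: x) = `|a| * N x;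
  norm_eq0 : forall x, N x = 0 -> x = 0 }.

End Model.

(* [isomw A] is Isom^w(model, A); it is meaningful only when A is an
   apartment. *)
Record apartment_system (R : realType) (D : root_datum) (T : Type) :=
  ApartmentSystem {
  apt : set (set T);
  isomw : set T -> set (model R D -> T) }.

Section Masure.
Context (R : realType) (D : root_datum) (g : km_algebra R[i] (@rd_cartan D)).
Context (T : Type) (M : apartment_system R D T).

Local Notation A_ := (model R D).

Definition apartment_structure (A : set T) : Prop :=
  exists2 f0 : A_ -> T, set_bij setT A f0 &
    isomw M A = [set f0 \o w | w in @affine_weyl R D].

(* Filters of an apartment are seen as filters on the whole set.  [F] is,
   inside A, a filter of the kind P. *)
Definition kind_in (P : set_system A_ -> Prop) (A : set T) (F : set_system T)
    : Prop :=
  exists f F0, [/\ isomw M A f, P F0 & F = fmap f F0].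
Definition kind (P : set_system A_ -> Prop) (F : set_system T) : Prop :=
  exists2 A, apt M A & kind_in P A F.

(* the enclosure cl_A(F), for a filter F contained in A *)
Definition encl (A : set T) (F : set_system T) : set_system T :=
  [set S | exists2 f, isomw M A f &
     cl g [set E | F (f @` E)] (f @^-1` S)].

Definition fixes (phi : T -> T) (F : set_system T) : Prop :=
  exists2 E, F E & forall x, E x -> phi x = x.

Definition Cup (F F' : set_system T) : set_system T :=
  [set S | exists E E', [/\ F E, F' E' & S = E `|` E']].

(* Only the restriction of phi to A matters. *)
Definition apt_iso (H : set (A_ -> A_)) (A A' : set T) (phi : T -> T) : Prop :=
  set_bij A A' phi /\
  forall f f', isomw M A f -> isomw M A' f' ->
    exists2 h, H h & phi \o f = f' \o h.
Definition weyl_iso := apt_iso (@affine_weyl R D).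
Definition vw_iso := apt_iso (@vw_aut R D).

Definition iso_from_model (A : set T) (psi : A_ -> T) : Prop :=
  set_bij setT A psi /\
  forall f, isomw M A f -> exists2 h, @vw_aut R D h & psi = f \o h.

(* (MA2) and (MA4) with the isomorphisms taken in Phi *)
Definition MA2_in (Phi : set (T -> T)) : Prop :=
  forall A A' F, apt M A -> apt M A' ->
    kind_in (@ma2_filter R D g) A F -> F A' ->
    encl A F (A `&` A') /\
    exists2 phi, Phi phi & weyl_iso A A' phi /\ fixes phi (encl A F).

Definition MA3_filter (F : set_system T) : Prop :=
  kind (@face R D g) F \/ kind (@solid_chimney_germ R D g) F.

Definition MA4_in (Phi : set (T -> T)) : Prop :=
  forall A A' Rg F, apt M A -> apt M A' ->
    kind (@splayed_chimney_germ R D g) Rg -> MA3_filter F ->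
    Rg A -> F A -> Rg A' -> F A' ->
    exists2 phi, Phi phi &
      weyl_iso A A' phi /\ fixes phi (encl A (Cup Rg F)).

Record is_masure : Prop := {
  masure_cover : forall x, exists2 A, apt M A & A x;
  masure_MA1 : forall A, apt M A -> apartment_structure A;
  masure_MA2 : MA2_in setT;
  masure_MA3 : forall Rg F, kind (@splayed_chimney_germ R D g) Rg ->
    MA3_filter F -> exists A, [/\ apt M A, Rg A & F A];
  masure_MA4 : MA4_in setT;
  masure_MAO : forall A A' f f' (x y x' y' : A_), apt M A -> apt M A' ->
    isomw M A f -> isomw M A' f' -> f x = f' x' -> f y = f' y' ->
    tits_le x y -> f @` segment x y = f' @` segment x' y' }.

(* the chambers having the filter P in their closure *)
Definition chambers_above (P : set_system T) : set (set_system T) :=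
  [set C | exists A f C0, [/\ apt M A, isomw M A f, chamber g C0,
     C = fmap f C0 & forall E, C0 E -> P (f @` closure E)]].
Definition thick_locally_finite : Prop :=
  forall P, kind (@panel R D g) P ->
    finite_set (chambers_above P) /\ (`I_3 #<= chambers_above P)%card.

Record strongly_transitive (G : groupType) (act : G -> T -> T) : Prop := {
  act_one : forall x, act 1%g x = x;
  act_mul : forall a b x, act (a * b)%g x = act a (act b x);
  act_apt : forall a A, apt M A -> apt M (act a @` A);
  act_iso : forall a A, apt M A -> vw_iso A (act a @` A) (act a);
  act_MA2 : MA2_in (range act);
  act_MA4 : MA4_in (range act) }.

(* The stabilizer of f0 (model) in G induces on it, read through f0, the group
   W^v semidirect Y. *)
Definition stabilizer_is_WY (G : groupType) (act : G -> T -> T)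
    (f0 : A_ -> T) : Prop :=
  [set h : A_ -> A_ | exists2 a, act a @` range f0 = range f0 & act a \o f0 = f0 \o h]
    = weyl_ltimes (@Y_lattice R D).

Definition sector_germ (e : bool) (s : set_system T) : Prop :=
  kind (@sector_germ_model R D e) s.

(* z = x +_s u, for s of sign e *)
Definition is_splus (e : bool) (s : set_system T) (x : T) (u : A_) (z : T) :
    Prop :=
  exists A psi y, [/\ apt M A, A x, s A, iso_from_model A psi &
    [/\ fmap psi (@pm_infty R D e) = s, psi y = x & z = psi (y + sgn e u)]].

Definition U_pairs (e : bool) (s : set_system T) (x x' : T) : set (A_ * A_) :=
  [set p | [/\ closure (@fund_chamber R D) p.1,
               closure (@fund_chamber R D) p.2 &
     exists2 z, is_splus e s x p.1 z & is_splus e s x' p.2 z]].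

Definition Theta (e : bool) : set ((A_ -> R) * set_system T) :=
  [set th | is_norm th.1 /\ sector_germ e th.2].

(* d_theta, for theta in Theta e *)
Definition dist (e : bool) (th : (A_ -> R) * set_system T) (x x' : T) : R :=
  inf [set th.1 p.1 + th.1 p.2 | p in U_pairs e th.2 x x'].

Definition affine_topology (A : set T) : set (set T) :=
  [set V | V `<=` A /\ forall f, isomw M A f -> open (f @^-1` V)].

End Masure.

Definition metric_topology (R : realType) (T : Type) (d : T -> T -> R) :
    set (set T) :=
  [set U | forall x, U x ->
     exists2 r, 0 < r & forall y, d x y < r -> U y].

Definition induced_topology (T : Type) (O : set (set T)) (A : set T) :
    set (set T) :=
  [set V | exists2 U, O U & V = A `&` U].

(* Main.v *)
(** Write [x +_s u] for the translate of [x] by a dominant vector [u] towards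
    the sector-germ [s].  On an apartment containing [s], the distance of [s] is
    equivalent to a norm, so the corollary amounts to the equivalence of the
    distances of two positive sector-germs [s] and [s'].  Some apartment contains
    both, hence they are joined by a gallery and one may assume that [q := s'] is
    the image of [s] under a simple reflection [r_i] of a chart.

    Let [A] be an apartment containing [s], and let [p] be in the closed panel
    direction fixed by [r_i].  Then [y +_s p = y +_q p] for every [y] in [A]:
    this holds deep in the sector, and it propagates along a line by real
    induction.  To go on past a point [y] for which it holds, take an apartment
    [B] containing [q] and a chamber of [A] at [y]; (MAO) forces [A] and [B] to
    share the segments from the points of this chamber to the points [y +_s p],
    and [B] to induce the same affine structure on them.  A small vector [z] of
    the chamber thus becomes a vector [v] of [B] such that [v + p] is in the Weyl
    orbit of the dominant vector [z + p] for all [p]; for large [p] this leaves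
    only [v = z] and [v = r_i z].  The retraction of [A] centred at [q] is
    therefore Lipschitz, and the two distances are comparable. *)

Require Import Defs.
From mathcomp Require Import all_boot all_order all_algebra.
From mathcomp Require Import all_classical all_reals all_analysis complex.
From mathcomp Require Import ring lra zify.

Set Implicit Arguments.
Unset Strict Implicit.
Unset Printing Implicit Defensive.

Import Order.TTheory GRing.Theory Num.Theory.
Import numFieldNormedType.Exports.
Local Open Scope classical_set_scope.
Local Open Scope ring_scope.

(** * Linear forms and words in the simple reflections *)

Section Forms.
Context (K : pzRingType) (n : nat).
Implicit Types (a b : 'rV[K]_n) (x y : 'cV[K]_n).

Lemma evDr a x y : ev a (x + y) = ev a x + ev a y.
Proof. by rewrite /ev mulmxDr mxE. Qed.

Lemma evNr a x : ev a (- x) = - ev a x.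
Proof. by rewrite /ev mulmxN mxE. Qed.

Lemma evBr a x y : ev a (x - y) = ev a x - ev a y.
Proof. by rewrite evDr evNr. Qed.

Lemma ev0r a : ev a 0 = 0.
Proof. by rewrite /ev mulmx0 mxE. Qed.

Lemma evMr a (w : 'M[K]_n) x : ev (a *m w) x = ev a (w *m x).
Proof. by rewrite /ev mulmxA. Qed.

Lemma evNl a x : ev (- a) x = - ev a x.
Proof. by rewrite /ev mulNmx mxE. Qed.

Lemma evZl k a x : ev (k *: a) x = k * ev a x.
Proof. by rewrite /ev -scalemxAl mxE. Qed.

Lemma ev_suml (J : finType) (f : J -> 'rV[K]_n) x :
  ev (\sum_j f j) x = \sum_j ev (f j) x.
Proof. by rewrite /ev mulmx_suml summxE. Qed.

End Forms.

Lemma evZr (K : comPzRingType) n (a : 'rV[K]_n) k (x : 'cV[K]_n) :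
  ev a (k *: x) = k * ev a x.
Proof. by rewrite /ev -scalemxAr mxE. Qed.

(** Eliminating either diagonal block of [block_mx 1 c a 1] gives two triangular factorisations with
    equal determinants. For a simple reflection the value is -1, so that the parity of the length of
    a word depends only on its matrix. *)
Lemma det_refl (K : comPzRingType) n (a : 'rV[K]_n) (c : 'cV[K]_n) :
  \det (1%:M - c *m a) = 1 - ev a c.
Proof.
have E1 : block_mx (1%:M - c *m a) c 0 1%:M *m block_mx 1%:M 0 a (1%:M : 'M[K]_1)
    = block_mx 1%:M c a 1%:M.
  rewrite mulmx_block !(mulmx1, mul1mx, mulmx0, mul0mx, add0r, addr0) subrK.
  by [].
have E2 : block_mx 1%:M 0 a (1%:M : 'M[K]_1) *m block_mx 1%:M c 0 (1%:M - a *m c)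
    = block_mx 1%:M c a 1%:M.
  by rewrite mulmx_block !(mulmx1, mul1mx, mulmx0, mul0mx, add0r, addr0) addrC subrK.
have /(congr1 (@determinant _ _)) := etrans E1 (esym E2).
rewrite !det_mulmx !det_lblock !det_ublock !det1 !mulr1 !mul1r => ->.
by rewrite det_mx11 /ev !mxE eqxx mulr1n.
Qed.

Section Weyl.
Context (R : realType) (D : root_datum).
Local Notation I := (rd_idx D).
Local Notation V := (model R D).
Local Notation c := (@rd_cartan D).
Local Notation al := (@sroot R D).
Local Notation co := (@scoroot R D).
Local Notation r := (@refl R D).

(** The closed fundamental chamber; [closure_fund_chamber] identifies it with the topological
    closure. *)
Definition dom : set V := [set v | forall i, 0 <= ev (al i) v].

Definition word (s : seq I) : 'M[R]_(rd_rank D) :=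
  foldr (fun i m => r i *m m) 1%:M s.

Definition reduced (s : seq I) : Prop :=
  forall t, word t = word s -> (size s <= size t)%N.

Lemma root_coroot i j : ev (al j) (co i) = (c i j)%:~R.
Proof.
rewrite -rd_pairing /ev !mxE rmorph_sum; apply: eq_bigr => k _.
by rewrite !mxE rmorphM.
Qed.

Lemma refl_mul i (v : V) : r i *m v = v - ev (al i) v *: co i.
Proof.
rewrite /refl mulmxBl mul1mx -mulmxA; congr (_ - _).
apply/matrixP => k l; rewrite !ord1 [RHS]mxE mulrC mxE big_ord1.
by [].
Qed.

Lemma ev_refl i j (v : V) :
  ev (al j) (r i *m v) = ev (al j) v - (c i j)%:~R * ev (al i) v.
Proof. by rewrite refl_mul evBr evZr root_coroot mulrC. Qed.

Lemma cartan_diag i : c i i = 2.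
Proof. exact: kmm_diag (rd_kac_moody D) i. Qed.

Lemma ev_refl_same i (v : V) : ev (al i) (r i *m v) = - ev (al i) v.
Proof. by rewrite ev_refl cartan_diag; ring. Qed.

Lemma reflK i : r i *m r i = 1%:M.
Proof.
rewrite /refl mulmxBl mul1mx mulmxBr mulmx1.
have -> : co i *m al i *m (co i *m al i) = 2%:R *: (co i *m al i).
  rewrite mulmxA -(mulmxA (co i)); set m := al i *m co i.
  have -> : m = 2%:R%:M.
    by rewrite [m]mx11_scalar -/(ev (al i) (co i)) root_coroot cartan_diag.
  by rewrite mul_mx_scalar scalemxAl.
by rewrite scaler_nat mulr2n; apply/matrixP => a b; rewrite !mxE; ring.
Qed.

Lemma refl_fix i (v : V) : ev (al i) v = 0 -> r i *m v = v.
Proof. by move=> h; rewrite refl_mul h scale0r subr0. Qed.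

Lemma word_cat s t : word (s ++ t) = word s *m word t.
Proof. by elim: s => [|i s /= ->]; rewrite ?mul1mx ?mulmxA. Qed.

Lemma word_revK s : word s *m word (rev s) = 1%:M.
Proof.
elim: s => [|i s IH]; first by rewrite mulmx1.
rewrite rev_cons -cats1 word_cat /= mulmx1 mulmxA -[r i *m _ *m _]mulmxA IH.
by rewrite mulmx1 reflK.
Qed.

Lemma det_word s : \det (word s) = (-1) ^+ size s.
Proof.
elim: s => [|i s IH] /=; first by rewrite det1.
rewrite det_mulmx IH exprS det_refl root_coroot cartan_diag; congr (_ * _).
by ring.
Qed.

Lemma word_parity s t : word s = word t -> odd (size s) = odd (size t).
Proof.
move=> /(congr1 (@determinant _ _)); rewrite !det_word.
rewrite -[(-1) ^+ size s]signr_odd -[(-1) ^+ size t]signr_odd.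
exact: signr_inj.
Qed.

Lemma reduced_exists s : exists2 t, word t = word s & reduced t.
Proof.
have ex : exists k, `[< exists2 t, word t = word s & size t = k >].
  by exists (size s); apply/asboolP; exists s.
case: (ex_minnP ex) => k /asboolP[t wt <-] kmin; exists t => // u wu.
by apply: kmin; apply/asboolP; exists u => //; rewrite wu.
Qed.

Lemma reduced_suffix s t : reduced (s ++ t) -> reduced t.
Proof.
move=> red u wu; have := red (s ++ u); rewrite !word_cat wu => /(_ erefl).
by rewrite !size_cat leq_add2l.
Qed.

Lemma reduced_prefix s t : reduced (s ++ t) -> reduced s.
Proof.
move=> red u wu; have := red (u ++ t); rewrite !word_cat wu => /(_ erefl).
by rewrite !size_cat leq_add2r.
Qed.

Lemma reduced_no_repeat i s : ~ reduced [:: i, i & s].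
Proof. by move/(_ s); rewrite /= mulmxA reflK mul1mx => /(_ erefl); lia. Qed.

Fixpoint alt (i j : I) k : seq I := if k is k.+1 then i :: alt j i k else [::].

Lemma size_alt i j k : size (alt i j k) = k.
Proof. by elim: k i j => //= k IH i j; rewrite IH. Qed.

Lemma alt_add i j k l :
  alt i j (k + l) = alt i j k ++ (if odd k then alt j i l else alt i j l).
Proof. by elim: k i j => //= k IH i j; rewrite IH; case: (odd k). Qed.

Lemma reduced_alt i j s : {subset s <= [:: i; j]} -> reduced (i :: s) ->
  i :: s = alt i j (size s).+1.
Proof.
elim: s i j => // k s IH i j sub red.
have ks : k \in [:: i; j] by apply: sub; rewrite mem_head.
have {ks} kj : k = j.
  move: ks; rewrite !inE => /orP[/eqP e|/eqP //].
  by move: red; rewrite e => /reduced_no_repeat.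
subst k; congr (_ :: _); apply: IH; last exact: (@reduced_suffix [:: i]).
move=> l ls; have : l \in [:: i; j] by apply: sub; rewrite inE ls orbT.
by rewrite !inE orbC.
Qed.

End Weyl.

(** * Rank two subgroups and the fundamental domain *)

Section RankTwo.
Context (R : realType) (D : root_datum).
Local Notation I := (rd_idx D).
Local Notation V := (model R D).
Local Notation c := (@rd_cartan D).
Local Notation al := (@sroot R D).
Local Notation co := (@scoroot R D).
Local Notation r := (@refl R D).
Local Notation word := (@word R D).

Lemma mulmx_ext (m n : nat) (A B : 'M[R]_(m, n)) :
  (forall v : 'cV[R]_n, A *m v = B *m v) -> A = B.
Proof.
move=> h; apply/matrixP => i j.
by have := h (delta_mx j 0); rewrite -!colE => /matrixP/(_ i 0); rewrite !mxE.
Qed.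

Lemma cartan_off i j : i != j -> c i j <= 0.
Proof. exact: kmm_off (rd_kac_moody D) i j. Qed.

(** A reflection turns the root [p al i + q al j] into one with coefficients [- c j i p - q] on
    [al j] and [p] on [al i]. The inequality between [p] and [q] is the invariant of the induction:
    it passes to the new pair because the product of the two Cartan entries is at least 4. *)
Lemma alt_root_ge0_infinite k i j (p q : R) (x : V) : i != j ->
  4 <= (c i j)%:~R * (c j i)%:~R :> R -> 0 <= p -> 0 <= q ->
  - (c i j)%:~R * q <= 2 * p -> 0 <= ev (al i) x -> 0 <= ev (al j) x ->
  0 <= p * ev (al i) (word (alt j i k) *m x)
     + q * ev (al j) (word (alt j i k) *m x).
Proof.
elim: k i j p q => [|k IH] i j p q ij N4 p0 q0 pq xi xj.
  by rewrite /= mul1mx addr_ge0 // mulr_ge0.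
have A0 : (c j i)%:~R <= 0 :> R by rewrite lerz0 cartan_off // eq_sym.
rewrite /= -mulmxA !ev_refl cartan_diag; set y := word _ *m x.
have -> : p * (ev (al i) y - (c j i)%:~R * ev (al j) y)
        + q * (ev (al j) y - 2%:~R * ev (al j) y)
    = (- (c j i)%:~R * p - q) * ev (al j) y + p * ev (al i) y by ring.
have h2 : 2 * q <= - (c j i)%:~R * p.
  have : 4 * q <= (c i j)%:~R * (c j i)%:~R * q by rewrite ler_wpM2r.
  have : - (c j i)%:~R * (- (c i j)%:~R * q) <= - (c j i)%:~R * (2 * p).
    by rewrite ler_wpM2l // oppr_ge0.
  by lra.
apply: IH => //; [by rewrite eq_sym | by rewrite mulrC | by lra | by lra].
Qed.

(** The rank two Cartan matrices of finite type, with the order [m] of the product of the two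
    reflections. B2 and G2 occur in both orientations because the pair [i], [j] is ordered. *)
Variant finite_type (i j : I) : nat -> Prop :=
| TypeA1A1 of c i j = 0 & c j i = 0 : finite_type i j 2
| TypeA2 of c i j = -1 & c j i = -1 : finite_type i j 3
| TypeB2 of c i j = -1 & c j i = -2 : finite_type i j 4
| TypeC2 of c i j = -2 & c j i = -1 : finite_type i j 4
| TypeG2 of c i j = -1 & c j i = -3 : finite_type i j 6
| TypeG2' of c i j = -3 & c j i = -1 : finite_type i j 6.

Lemma rank_two_type i j : i != j ->
  4 <= c i j * c j i \/ exists m, finite_type i j m.
Proof.
move=> ij; have a0 := cartan_off ij.
have b0 : c j i <= 0 by rewrite cartan_off // eq_sym.
have z := kmm_zero (rd_kac_moody D) i j.
case: (lerP 4 (c i j * c j i)) => [|N4]; first by left.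
right; case: (eqVneq (c i j) 0) => [a|a].
  by exists 2; constructor => //; apply/z.
have b : c j i != 0 by apply: contra a => /eqP b; apply/eqP/z.
have [a1|a1] := eqVneq (c i j) (-1).
  have : [\/ c j i = -1, c j i = -2 | c j i = -3].
    rewrite a1 in N4; have : c j i = -1 \/ c j i = -2 \/ c j i = -3 by lia.
    by case=> [->|[->|->]]; [constructor 1|constructor 2|constructor 3].
  by case=> h; [exists 3; constructor | exists 4; constructor
               | exists 6; constructor].
have [b1|b1] := eqVneq (c j i) (-1).
  rewrite b1 in N4; have : c i j = -2 \/ c i j = -3 by lia.
  by case=> h; [exists 4; constructor | exists 6; constructor].
by exfalso; nia.
Qed.

Lemma alt_root_ge0_finite m k i j (x : V) : finite_type i j m ->
  (k < m)%N -> 0 <= ev (al i) x -> 0 <= ev (al j) x ->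
  0 <= ev (al i) (word (alt j i k) *m x).
Proof.
by case=> cij cji; do 6?[case: k => [|k] //=]; rewrite ?mul1mx // => _ xi xj;
  rewrite -!mulmxA ?mul1mx !(ev_refl, cartan_diag, cij, cji); lra.
Qed.

(** Both reflections preserve the vectors of this form and act on the coordinates [x], [y] by affine
    maps, so that the braid relation becomes a computation with two scalars. *)
Definition coroot_shift i j (v : V) x y : V := v + x *: co i + y *: co j.

Lemma refl_shiftl i j (v : V) x y :
  r i *m coroot_shift i j v x y
    = coroot_shift i j v (- x - ev (al i) v - (c j i)%:~R * y) y.
Proof.
rewrite /coroot_shift refl_mul !evDr !evZr !root_coroot cartan_diag.
by apply/matrixP => k l; rewrite !mxE; ring.
Qed.

Lemma refl_shiftr i j (v : V) x y :
  r j *m coroot_shift i j v x y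
    = coroot_shift i j v x (- y - ev (al j) v - (c i j)%:~R * x).
Proof.
have sC i' j' x' y' : coroot_shift i' j' v x' y' = coroot_shift j' i' v y' x'.
  by rewrite /coroot_shift addrAC.
by rewrite sC refl_shiftl sC.
Qed.

Lemma braid m i j : finite_type i j m -> word (alt i j m) = word (alt j i m).
Proof.
move=> ft; apply: mulmx_ext => v.
have -> : v = coroot_shift i j v 0 0.
  by rewrite /coroot_shift !scale0r !addr0.
have sl := @refl_shiftl i j v; have sr := @refl_shiftr i j v.
by case: ft => -> -> in sl sr *; rewrite /= -!mulmxA !mul1mx;
  do ?rewrite (sl, sr); congr coroot_shift; ring.
Qed.

(** An alternating word of [m + 1] letters can be shortened by two: the braid relation on its last
    [m] letters makes its first two letters equal, and they cancel. *)
Lemma not_reduced_alt m k i j : finite_type i j m -> (m <= k)%N ->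
  ~ reduced R (alt i j k.+1).
Proof.
move=> ft mk; have -> : k.+1 = (m.+1 + (k - m))%N by lia.
rewrite alt_add => /reduced_prefix red.
have m0 : (0 < m)%N by case: ft.
have := red (alt j i m.-1); rewrite !size_alt => h.
suff /h : word (alt j i m.-1) = word (alt i j m.+1) by lia.
by rewrite /= -(braid ft) -{2}(prednK m0) /= mulmxA reflK mul1mx.
Qed.

Lemma alt_root_ge0 k i j (x : V) : i != j -> reduced R (alt i j k.+1) ->
  0 <= ev (al i) x -> 0 <= ev (al j) x ->
  0 <= ev (al i) (word (alt j i k) *m x).
Proof.
move=> ij red xi xj; case: (rank_two_type ij) => [N4|[m ft]].
  have := @alt_root_ge0_infinite k i j 1 0 x ij.
  rewrite mul1r mul0r addr0; apply=> //; last by rewrite mulr0 mulr1.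
  by rewrite -intrM (ler_int _ 4).
case: (ltnP k m) => km; first exact: alt_root_ge0_finite ft km xi xj.
by case: (not_reduced_alt ft km red).
Qed.

(* Humphreys, Reflection groups and Coxeter groups, Theorem 5.4: split off a
   longest prefix in the two letters [i] and [j], where [j] is the first letter
   of [s], and treat that prefix by [alt_root_ge0]. *)
Lemma reduced_root_ge0 i s (x : V) : reduced R (i :: s) -> dom x ->
  0 <= ev (al i) (word s *m x).
Proof.
move: {2}(size s) (leqnn (size s)) => n; elim: n i s => [|n IH] i s sn red dx.
  by rewrite (size0nil (s := s)) ?mul1mx //; lia.
case: s sn red => [|j s] sn red; first by rewrite mul1mx.
have ij : i != j.
  by apply/eqP => e; subst j; apply: reduced_no_repeat red.
pose split k := `[< exists u t, [/\ {subset u <= [:: i; j]}, size u = k,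
  word (u ++ t) = word (j :: s) & (k + size t = (size s).+1)%N] >].
have ex : exists k, split k.
  exists 1; apply/asboolP; exists [:: j], s; split=> //.
  by move=> l; rewrite !inE => ->; rewrite orbT.
have ub k : split k -> (k <= (size s).+1)%N.
  by move=> /asboolP[u [t [_ _ _ <-]]]; lia.
case: (ex_maxnP ex ub) => k /asboolP[u [t [sub uk wut skt]]] kmax.
have k1 : (1 <= k)%N.
  apply: kmax; apply/asboolP; exists [:: j], s; split=> //.
  by move=> l; rewrite !inE => ->; rewrite orbT.
have redut : reduced R (i :: u ++ t).
  move=> t' wt'; have /red : word t' = word (i :: j :: s).
    by rewrite wt' /= wut.
  by rewrite /= size_cat uk skt.
(* If [l :: t] is not reduced, parity gives an equivalent [t'] shorter than [t]; moving [l] to the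
   end of [u] then yields a longer prefix in the two letters, against the maximality of [k]. *)
have redt l : l \in [:: i; j] -> reduced R (l :: t).
  move=> lij; case: (reduced_exists R (l :: t)) => t' wt' redt' t'' wt''.
  suff <- : size t' = size (l :: t) by apply: redt'; rewrite wt' wt''.
  have le := redt' (l :: t) (esym wt').
  have par := word_parity wt'.
  case: (ltnP (size t') (size (l :: t))) => h; last by apply/eqP; rewrite eqn_leq le h.
  have : (k.+1 <= k)%N; last by lia.
  apply: kmax; apply/asboolP; exists (rcons u l), t'; split.
  - move=> l'; rewrite mem_rcons inE => /orP[/eqP -> //|]; exact: sub.
  - by rewrite size_rcons uk.
  - rewrite -wut -cats1 -catA !word_cat /= wt' /= mulmx1 !mulmxA.
    by rewrite -(mulmxA (word u)) reflK mulmx1.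
  - have /redut : word (i :: rcons u l ++ t') = word (i :: u ++ t).
      rewrite /= -cats1 -catA !word_cat /= wt' /= mulmx1 !mulmxA.
      by rewrite -(mulmxA (r i *m word u)) reflK mulmx1.
    have : size t' <> size t by move=> e; move: par; rewrite /= e; case: odd.
    move: h skt; rewrite /= !size_cat size_rcons /= uk.
    by move: (size s) (size t) (size t') => a b b'; lia.
have tn : (size t <= n)%N.
  by move: sn skt k1; rewrite /=; move: (size s) (size t) => a b; lia.
have xi : 0 <= ev (al i) (word t *m x).
  by apply: IH => //; apply: redt; rewrite inE eqxx.
have xj : 0 <= ev (al j) (word t *m x).
  by apply: IH => //; apply: redt; rewrite !inE eqxx orbT.
have redu : reduced R (i :: u) by exact: (@reduced_prefix _ _ (i :: u) t).
have [eu] : i :: u = alt i j k.+1 by rewrite -uk; exact: reduced_alt sub redu.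
rewrite -wut word_cat -mulmxA eu; apply: alt_root_ge0 => //.
by rewrite /= -eu.
Qed.

Lemma dom_stabilizer (w : 'M[R]_(rd_rank D)) (v : V) :
  weyl w -> dom v -> dom (w *m v) ->
  w *m v = v /\ exists2 s, w = word s & forall i, i \in s -> ev (al i) v = 0.
Proof.
move=> [s0 ws0] dv; have [s ws red] := reduced_exists R s0.
have {s0 ws0 ws} -> : w = word s by rewrite ws ws0.
move=> dwv; suff [h1 h2] : word s *m v = v /\ forall i, i \in s -> ev (al i) v = 0.
  by split=> //; exists s.
elim: s red dwv => [|i s IH] red /=; first by rewrite mul1mx.
rewrite -mulmxA => dwv; have h := reduced_root_ge0 red dv.
have h0 : ev (al i) (word s *m v) = 0.
  by have := dwv i; rewrite ev_refl_same; move: h; lra.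
move: dwv; rewrite (refl_fix h0) => dwv.
have [e hs] := IH (@reduced_suffix _ _ [:: i] s red) dwv.
by split=> // l; rewrite inE => /orP[/eqP->|/hs //]; rewrite -[in RHS]h0 e.
Qed.

End RankTwo.

(** * Vectorial faces *)

Section Limits.
Context (R : realFieldType).

Lemma slope_ge0 (a b : R) : (forall t, 0 <= t -> 0 <= a + t * b) -> 0 <= b.
Proof.
move=> h; case: (lerP 0 b) => // b0; have a0 := h 0 (lexx 0).
rewrite mul0r addr0 in a0.
have t0 : 0 <= (a + 1) / - b by rewrite divr_ge0 //; lra.
have := h _ t0; suff -> : a + (a + 1) / - b * b = -1 by lra.
by field; rewrite lt_eqF.
Qed.

Lemma limit_ge0 (a b e : R) : 0 < e ->
  (forall t, 0 < t -> t < e -> 0 <= a + t * b) -> 0 <= a.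
Proof.
move=> e0 h; case: (lerP 0 a) => // a0.
have b1 : 0 < 2 * (`|b| + 1) by have := normr_ge0 b; lra.
(* Small enough that [t * b <= - a / 2], so that [a + t * b] would still be negative. *)
pose t := Num.min (e / 2) (- a / (2 * (`|b| + 1))).
have t0 : 0 < t by rewrite lt_min divr_gt0 //= divr_gt0 //; lra.
have te : t < e by rewrite gt_min; apply/orP; left; lra.
have h1 : t * (2 * (`|b| + 1)) <= - a by rewrite -ler_pdivlMr // ge_min lexx orbT.
have h2 : t * b <= t * `|b| by rewrite ler_pM2l // ler_norm.
by have := h _ t0 te; nra.
Qed.

End Limits.

(** * The sup norm on column vectors *)

Section Norm.
Context (R : realType) (n : nat).
Implicit Types (x y : 'cV[R]_n).

Lemma nbhs_cVP x (A : set 'cV[R]_n) :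
  nbhs x A <-> exists2 e : R, 0 < e & forall y, `|y| < e -> A (x + y).
Proof.
split=> [/nbhs_ballP[e /= e0 h]|[e e0 h]].
  exists e => // y ye; apply: h; rewrite -ball_normE /=.
  by rewrite opprD addrA subrr sub0r normrN.
apply/nbhs_ballP; exists e => // y; rewrite -ball_normE /= => ye.
by rewrite -(subrK x y) addrC; apply: h; rewrite distrC.
Qed.

Lemma entry_le_norm x k : `|x k 0| <= `|x|.
Proof.
rewrite [leRHS]/Num.Def.normr /= mx_normrE; apply/bigmax_geP; right => /=.
by exists (k, 0).
Qed.

Lemma ev_bounded (a : 'rV[R]_n) :
  exists2 K : R, 0 < K & forall x, `|ev a x| <= K * `|x|.
Proof.
exists (1 + \sum_k `|a 0 k|).
  by rewrite ltr_pwDl // sumr_ge0.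
move=> x; rewrite /ev mxE (le_trans (ler_norm_sum _ _ _)) //.
rewrite mulrDl mul1r -[leLHS]add0r lerD // mulr_suml ler_sum // => k _.
by rewrite normrM ler_wpM2l // entry_le_norm.
Qed.

Lemma finite_bound (J : finType) (f : J -> R) :
  exists2 K : R, 0 < K & forall j, f j <= K.
Proof.
exists (1 + \sum_j `|f j|); first by rewrite ltr_pwDl // sumr_ge0.
move=> j; rewrite (bigD1 j) //= addrCA (le_trans (ler_norm _)) // lerDl.
by rewrite addr_ge0 // sumr_ge0.
Qed.

Lemma finite_lower_bound (J : finType) (f : J -> R) :
  (forall j, 0 < f j) -> exists2 e : R, 0 < e & forall j, e <= f j.
Proof.
move=> f0; have [K K0 hK] := finite_bound (fun j => (f j)^-1).
exists K^-1; first by rewrite invr_gt0.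
by move=> j; rewrite -[leRHS]invrK lef_pV2 // posrE invr_gt0.
Qed.

Lemma forms_bounded (J : finType) (a : J -> 'rV[R]_n) :
  exists2 K : R, 0 < K & forall j x, `|ev (a j) x| <= K * `|x|.
Proof.
have [K0 hK] : exists K : J -> R, forall j x, `|ev (a j) x| <= K j * `|x|.
  have /choice[K hK] : forall j, exists K, forall x, `|ev (a j) x| <= K * `|x|.
    by move=> j; have [K _ hK] := ev_bounded (a j); exists K.
  by exists K.
have [K K1 h] := finite_bound K0; exists K => // j x.
by rewrite (le_trans (hK j x)) // ler_wpM2r.
Qed.

Lemma closure_cVP x (A : set 'cV[R]_n) :
  closure A x <-> forall e : R, 0 < e -> exists2 y, `|y| < e & A (x + y).
Proof.
split=> [cl e e0|h B /nbhs_cVP[e e0 hB]].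
  have /cl[y [Ay hy]] : nbhs x [set y | `|y - x| < e].
    by apply/nbhs_cVP; exists e => // y ye /=; rewrite addrAC subrr add0r.
  by exists (y - x) => //; rewrite addrCA subrr addr0.
by have [y ye Ay] := h e e0; exists (x + y); split=> //; apply: hB.
Qed.

End Norm.

(** * Coweights, closed faces and the Weyl group *)

Section Cones.
Context (R : realType) (D : root_datum).
Local Notation I := (rd_idx D).
Local Notation V := (model R D).
Local Notation al := (@sroot R D).
Local Notation word := (@word R D).

(** Multiplying a rational relation by the product [d] of its denominators makes it integral. *)
Lemma lin_indep_row_free (J : finType) n (a : J -> 'rV[int]_n) : lin_indep a ->
  row_free (\matrix_(k < #|J|) map_mx (intr : int -> rat) (a (enum_val k))).
Proof.
move=> ind; apply/inj_row_free => u uA.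
pose d := \prod_k denq (u 0 k).
have d0 : d != 0 by rewrite prodf_seq_neq0; apply/allP => k _; exact: denq_neq0.
have /choice[z hz] : forall k, exists z : int, z%:~R = d%:~R * u 0 k.
  move=> k; rewrite /d (bigD1 k) //= intrM mulrAC [_ * u 0 k]mulrC -numqE -intrM.
  by eexists; reflexivity.
have h : forall j, z (enum_rank j) = 0.
  apply: ind; apply/rowP => l; rewrite [RHS]mxE; apply/eqP; rewrite -(intr_eq0 rat); apply/eqP.
  have /rowP/(_ l) := uA; rewrite !mxE => /(congr1 ( *%R d%:~R)).
  rewrite mulr0 => <-; rewrite summxE rmorph_sum mulr_sumr /=.
  rewrite (reindex (@enum_val J predT)) /=; last exact/onW_bij/enum_val_bij.
  apply: eq_bigr => k _; by rewrite !mxE enum_valK intrM hz mulrA.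
apply/rowP => k; rewrite [RHS]mxE; apply: (@mulfI _ d%:~R).
  by rewrite intr_eq0.
by rewrite mulr0 -hz -[k]enum_valK h.
Qed.

(** The matrix of simple roots is inverted on the right over the rationals, where independence over
    the integers suffices; the columns of the inverse are then read as real vectors. *)
Lemma fundamental_coweights :
  exists om : I -> V, forall i j, ev (al i) (om j) = (i == j)%:R.
Proof.
have /mulmxVp := lin_indep_row_free (@rd_root_free D).
set A := \matrix_k _; move: (pinvmx A) => P AB.
pose B := map_mx (ratr : rat -> R) P.
exists (fun j => col (enum_rank j) B) => i j.
have /matrixP/(_ (enum_rank i) (enum_rank j)) := AB.
rewrite !mxE (inj_eq enum_rank_inj) => /(congr1 (ratr : rat -> R)).
rewrite rmorph_nat => <-; rewrite /ev !mxE rmorph_sum; apply: eq_bigr => k _.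
by rewrite !mxE enum_rankK rmorphM /= ratr_int.
Qed.

(** This supplies most explicit vectors below: points of a given face, dominant vectors beyond a
    given bound, and a vector on which all simple roots are 1. *)
Lemma interpolate (f : I -> R) : exists v : V, forall i, ev (al i) v = f i.
Proof.
have [om hom] := fundamental_coweights.
exists (\sum_j f j *: om j) => i.
rewrite /ev mulmx_sumr summxE (bigD1 i) //= big1 ?addr0 => [|j ji].
  by rewrite -/(ev _ _) evZr hom eqxx mulr1.
by rewrite -/(ev _ _) evZr hom eq_sym (negbTE ji) mulr0.
Qed.

Definition cface (J : {set I}) : set V :=
  [set v | forall i, if i \in J then ev (al i) v = 0 else 0 <= ev (al i) v].

Lemma fund_face_nonempty (J : {set I}) : exists p : V, fund_face J p.
Proof.
have [p hp] := interpolate (fun i => if i \in J then 0 else 1).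
by exists p => i; rewrite hp; case: (i \in J) => //; rewrite ltr01.
Qed.

Lemma fund_face_cface (J : {set I}) (p : V) : fund_face J p -> cface J p.
Proof. by move=> h i; have := h i; case: ifP => // _ /ltW. Qed.

Lemma cface_dom (J : {set I}) (p : V) : cface J p -> dom p.
Proof. by move=> h i; have := h i; case: ifP => // _ ->. Qed.

Lemma cface_add (J : {set I}) (p q : V) : cface J p -> cface J q -> cface J (p + q).
Proof.
move=> hp hq i; have := hp i; have := hq i; rewrite evDr.
by case: (i \in J) => [-> ->|]; [rewrite addr0 | move=> ? ?; exact: addr_ge0].
Qed.

Lemma fund_face_add (J : {set I}) (p q : V) :
  fund_face J p -> cface J q -> fund_face J (p + q).
Proof.
move=> hp hq i; have := hp i; have := hq i; rewrite evDr.
by case: (i \in J) => [-> ->|? ?]; [rewrite addr0 | rewrite ltr_wpDr].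
Qed.

Lemma fund_face_scale (J : {set I}) (p : V) (t : R) : 0 < t ->
  fund_face J p -> fund_face J (t *: p).
Proof.
move=> t0 hp i; have := hp i; rewrite evZr.
by case: (i \in J) => [->|]; [rewrite mulr0 | rewrite pmulr_rgt0].
Qed.

Lemma cface_scale (J : {set I}) (p : V) (t : R) : 0 <= t ->
  cface J p -> cface J (t *: p).
Proof.
move=> t0 hp i; have := hp i; rewrite evZr.
by case: (i \in J) => [->|]; [rewrite mulr0 | move=> ?; exact: mulr_ge0].
Qed.

Lemma fund_face0 : @fund_face R D finset.set0 = @fund_chamber R D.
Proof.
by apply/seteqP; split=> v h i; have := h i; rewrite finset.in_set0.
Qed.

Lemma closure_fund_face (J : {set I}) : closure (@fund_face R D J) = cface J.
Proof.
have [K K0 hK] := forms_bounded (fun i => al i).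
apply/seteqP; split=> [v /closure_cVP cl i|v hv].
  case: ifP => iJ.
    apply/eqP; rewrite -normr_le0; apply/ler_addgt0Pr => e e0; rewrite add0r.
    have [y ye /(_ i)] := cl (e / K) (divr_gt0 e0 K0).
    rewrite iJ evDr => /eqP; rewrite addr_eq0 => /eqP ->; rewrite normrN.
    by rewrite (le_trans (hK _ _)) // mulrC -ler_pdivlMr // ltW.
  apply/ler_addgt0Pr => e e0.
  have [y ye /(_ i)] := cl (e / K) (divr_gt0 e0 K0).
  rewrite iJ evDr => h; rewrite (le_trans (ltW h)) // lerD2l.
  rewrite (le_trans (ler_norm _)) // (le_trans (hK _ _)) //.
  by rewrite mulrC -ler_pdivlMr // ltW.
apply/closure_cVP => e e0; have [p hp] := fund_face_nonempty J.
have p1 : 0 < `|p| + 1 by have := normr_ge0 p; lra.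
exists ((e / (`|p| + 1)) *: p); last first.
  by rewrite addrC; apply: fund_face_add => //; apply: fund_face_scale => //; rewrite divr_gt0.
rewrite normrZ ger0_norm; last by rewrite divr_ge0 // ltW.
by rewrite mulrAC ltr_pdivrMr // ltr_pM2l //; lra.
Qed.

Lemma closure_fund_chamber : closure (@fund_chamber R D) = @dom R D.
Proof.
rewrite -fund_face0 closure_fund_face.
by apply/seteqP; split=> v h i; have := h i; rewrite finset.in_set0.
Qed.

(** By [dom_stabilizer], the simple root of every letter of some word for [w] vanishes at [v]; no
    simple root does so in the open chamber, hence the word is empty. *)
Lemma chamber_face_weyl (w : 'M[R]_(rd_rank D)) (v : V) : weyl w ->
  @fund_chamber R D v -> dom (w *m v) -> w = 1%:M.
Proof.
move=> ww cv; have dv : dom v by move=> i; exact: ltW.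
case/(dom_stabilizer ww dv) => _ [[|i s] // -> /(_ i (mem_head _ _)) h].
by have := cv i; rewrite h ltxx.
Qed.

Lemma weyl1 : weyl (1%:M : 'M[R]_(rd_rank D)).
Proof. by exists [::]. Qed.

Lemma weyl_refl i : weyl (refl R i : 'M[R]_(rd_rank D)).
Proof. by exists [:: i]; rewrite /= mulmx1. Qed.

Lemma weylM (w w' : 'M[R]_(rd_rank D)) : weyl w -> weyl w' -> weyl (w *m w').
Proof. by move=> [s ->] [s' ->]; exists (s ++ s'); rewrite [RHS]word_cat. Qed.

Lemma weyl_inverse (w : 'M[R]_(rd_rank D)) : weyl w ->
  exists2 w', weyl w' & w' *m w = 1%:M /\ w *m w' = 1%:M.
Proof.
move=> [s ->]; exists (word (rev s)); first by exists (rev s).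
by split; [rewrite -{2}(revK s) word_revK | exact: word_revK].
Qed.

End Cones.

(** * Germs at infinity, roots and enclosures in the model *)

Section Germs.
Context (R : realType) (D : root_datum) (g : km_algebra R[i] (@rd_cartan D)).
Local Notation I := (rd_idx D).
Local Notation V := (model R D).
Local Notation al := (@sroot R D).
Local Notation mat := 'M[R]_(rd_rank D).

(** For [J] empty this is the germ at plus infinity, by [pm_inftyE]. The other positive sector-germs
    are obtained from it by changing the chart. *)
Definition germ (J : {set I}) : set_system V := germ_infty 0 (fund_face J).

(** With a base point in the open face, the closed face can be used above it, and germs are
    intersected by adding base points. *)
Lemma germP (J : {set I}) (E : set V) :
  germ J E <-> exists2 u, fund_face J u & forall p, cface J p -> E (u + p).
Proof.
split=> [[u]|[u hu h]].
  rewrite closure_fund_face add0r => hu h; have [p0 hp0] := fund_face_nonempty R J.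
  exists (u + p0); first by rewrite addrC; exact: fund_face_add.
  move=> p hp; apply: h; exists (p0 + p); first exact: fund_face_add.
  by rewrite addrA.
exists u; first exact: subset_closure.
rewrite add0r => _ [p hp <-]; apply: h; exact: fund_face_cface.
Qed.

Lemma germ_sub (J : {set I}) (E E' : set V) : germ J E -> E `<=` E' -> germ J E'.
Proof. by move=> /germP[u hu h] sub; apply/germP; exists u => // p /h/sub. Qed.

Lemma germI (J : {set I}) (E E' : set V) : germ J E -> germ J E' -> germ J (E `&` E').
Proof.
move=> /germP[u hu h] /germP[u' hu' h']; apply/germP; exists (u + u').
  by apply: fund_face_add => //; exact: fund_face_cface.
move=> p hp; split.
  by rewrite -addrA; apply: h; apply: cface_add => //; exact: fund_face_cface.
by rewrite addrAC addrC; apply: h'; apply: cface_add => //; exact: fund_face_cface.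
Qed.

Lemma germ_nonempty (J : {set I}) (E : set V) : germ J E -> exists2 u, E u & fund_face J u.
Proof.
move=> /germP[u hu h]; exists u => //; rewrite -[u]addr0; apply: h => i.
by rewrite ev0r; case: ifP.
Qed.

Lemma germT (J : {set I}) : germ J setT.
Proof.
by have [p hp] := fund_face_nonempty R J; apply/germP; exists p.
Qed.

Lemma pm_inftyE : pm_infty false = germ finset.set0.
Proof.
rewrite /pm_infty /germ fund_face0; congr germ_infty.
apply/seteqP; split=> [_ [v hv <-]|v hv]; first by rewrite /sgn expr0 scale1r.
by exists v => //; rewrite /sgn expr0 scale1r.
Qed.

Lemma cface0 : cface finset.set0 = @dom R D.
Proof. by apply/seteqP; split=> v h i; have := h i; rewrite finset.in_set0. Qed.

Lemma dominant_shift (v : V) :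
  exists2 u : V, fund_chamber u & fund_chamber (u + v).
Proof.
have [K K0 hK] := forms_bounded al.
have [u hu] := interpolate (fun _ : I => K * `|v| + 1).
have Kv : 0 <= K * `|v| by rewrite mulr_ge0 // ltW.
exists u => i; rewrite ?evDr hu; first lra.
by have := hK i v; rewrite ler_norml => /andP[]; lra.
Qed.

Lemma germ_translate (v : V) (E : set V) :
  germ finset.set0 E <-> germ finset.set0 [set x | E (x + v)].
Proof.
suff h w F : germ finset.set0 F -> germ finset.set0 [set x | F (x + w)].
  split; first exact: h.
  by move=> /(h (- v))/germ_sub; apply => x /=; rewrite subrK.
move=> /germP[u hu h]; have [u' hu' hu'w] := dominant_shift w.
apply/germP; exists (u + u').
  apply: fund_face_add => //; apply: fund_face_cface; by rewrite fund_face0.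
move=> p hp /=.
have -> : u + u' + p + w = u + (u' + w + p).
  by rewrite -!addrA [p + w]addrC.
apply: h; apply: cface_add => //; apply: fund_face_cface; by rewrite fund_face0.
Qed.

(** Along a ray of the face, the simple roots of the image are affine functions that stay
    nonnegative, so their slopes are nonnegative. *)
Lemma germ_stable_weyl (J : {set I}) (w : mat) (v : V) : weyl w ->
  germ J (aff w v @^-1` fund_face J) ->
  exists2 p, fund_face J p & dom (w *m p).
Proof.
move=> ww /germP[u hu h]; have [p0 hp0] := fund_face_nonempty R J.
exists p0 => // i; apply: (@slope_ge0 _ (ev (al i) (w *m u + v))) => t t0.
have /h/fund_face_cface/cface_dom/(_ i) : cface J (t *: p0).
  by apply: cface_scale => //; exact: fund_face_cface.
by rewrite /aff mulmxDr -scalemxAr !evDr evZr; lra.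
Qed.

Lemma linear_fun0 (U W : lmodType R[i]) (f : U -> W) : linear f -> f 0 = 0.
Proof.
move=> lf; have := lf (- 1) 0 0.
by rewrite scaler0 addr0 => {1}->; rewrite scaleN1r addrC subrr.
Qed.

Lemma sum_delta (K : pzRingType) (W : lmodType K) (F : I -> W) k i :
  \sum_j (((j == i)%:R * k : int)%:~R : K) *: F j = k%:~R *: F i.
Proof.
rewrite (bigD1 i) //= eqxx mul1r big1 ?addr0 // => j /negbTE ->.
by rewrite mul0r scale0r.
Qed.

(** The bracket is the simple coroot, which is nonzero by independence. Hence [km_e g i] and
    [km_f g i] are nonzero, and the simple roots and their opposites are available in enclosures. *)
Lemma km_ef_neq0 i : km_bracket (km_e g i) (km_f g i) != 0.
Proof.
rewrite (@km_ef _ _ _ g) eqxx -(linear_fun0 (@km_h_linear _ _ _ g)).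
apply/eqP => /(@km_h_inj _ _ _ g) z.
have := @km_coroot_free _ _ _ g (fun j => ((j == i)%:R * 1 : int)%:~R).
rewrite sum_delta scale1r => /(_ z i)/eqP.
by rewrite eqxx mul1r oner_eq0.
Qed.

Lemma sroot_all_root i : all_root g (al i).
Proof.
exists (fun j => (j == i)%:R * 1); last by rewrite sum_delta scale1r.
split; first by exists i; rewrite eqxx.
exists (km_e g i); last by move=> a; rewrite km_he sum_delta scale1r.
apply: contraNneq (km_ef_neq0 i) => ->.
by rewrite (linear_fun0 (@km_bracket_linear_l _ _ _ g _)).
Qed.

Lemma opp_sroot_all_root i : all_root g (- al i).
Proof.
exists (fun j => (j == i)%:R * -1); last by rewrite sum_delta scaleN1r.
split; first by exists i; rewrite eqxx mul1r.
exists (km_f g i); last by move=> a; rewrite km_hf sum_delta scaleN1r evNl.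
apply: contraNneq (km_ef_neq0 i) => ->.
by rewrite (linear_fun0 (@km_bracket_linear_r _ _ _ g _)).
Qed.

(** The enclosure of a filter consists of the sets containing some hull that belongs to the
    filter. *)
Definition hull (k : Defs.form R D -> option int) : set V :=
  \bigcap_(a in all_root g) hspace a (k a).

(** A half-space containing one translate of a cone is bounded by a form that is nonnegative on the
    cone, so it contains the cone based at any of its own points. *)
Lemma hull_cone (J : {set I}) k (w : mat) v y u :
  hull k (aff w v y) -> (forall p, cface J p -> hull k (aff w v (u + p))) ->
  forall p, cface J p -> hull k (aff w v (y + p)).
Proof.
move=> hy hu p hp a ra; have := hy a ra; case ka: (k a) => [z|] //=.
have a0 : 0 <= ev a (w *m p).
  apply: (@slope_ge0 _ (ev a (aff w v u) + z%:~R)) => t t0.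
  have := hu (t *: p) (cface_scale t0 hp) a ra; rewrite ka /=.
  by rewrite /aff !mulmxDr -scalemxAr !evDr evZr; lra.
by rewrite /aff !mulmxDr !evDr; lra.
Qed.

Lemma hull_limit k (w : mat) v y d (e : R) : 0 < e ->
  (forall t, 0 < t -> t < e -> hull k (aff w v (y + t *: d))) ->
  hull k (aff w v y).
Proof.
move=> e0 h a ra; case ka: (k a) => [z|] //=.
apply: (@limit_ge0 _ _ (ev a (w *m d)) e) => // t t0 te.
have := h t t0 te a ra; rewrite ka /=.
by rewrite /aff !mulmxDr -scalemxAr !evDr evZr; lra.
Qed.

(** The minimal vectorial face, on which all roots vanish; it turns a point into a face, as (MA3)
    and (MA4) require. *)
Local Notation V0 := (@fund_face R D [set: I]%SET).

Lemma all_root_V0 a p : all_root g a -> V0 p -> ev a p = 0.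
Proof.
move=> [b _ ->] hp; rewrite ev_suml big1 // => i _.
by rewrite evZl; have := hp i; rewrite inE => ->; rewrite mulr0.
Qed.

Lemma V0_0 : V0 0.
Proof. by move=> i; rewrite inE ev0r. Qed.

Lemma face_atT x Fv : face_at g x Fv setT.
Proof.
by exists (fun=> None), (fun=> None), setT; split=> //; exact: filterT.
Qed.

Lemma face_at_point x E : face_at g x V0 E -> E x.
Proof.
move=> [k [k' [Om [/nbhs_singleton Omx h]]]]; apply; apply: h; split=> //.
by exists 0; [exact: V0_0 | rewrite addr0].
Qed.

Lemma face_at_cone x Fv E : face_at g x Fv E ->
  exists2 e : R, 0 < e & forall v, Fv v -> `|v| < e -> E (x + v).
Proof.
move=> [k [k' [Om [/nbhs_cVP[e e0 hOm] h hE]]]].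
by exists e => // v hv ve; apply/hE/h; split; [exact: hOm | exists v].
Qed.

Lemma hull_face_at x k : hull k x -> face_at g x V0 (hull k).
Proof.
move=> hx; exists k, (fun=> None), setT; split; first exact: filterT.
  move=> _ [_ [p hp <-]] a ra; split=> //; have := hx a ra.
  by case: (k a) => //= z; rewrite evDr (all_root_V0 ra hp) addr0.
by move=> y hy a ra; case: (hy a ra).
Qed.

Lemma vface_fund J : @vface R D (fund_face J).
Proof.
exists false, 1%:M, J; split; first exact: weyl1.
apply/seteqP; split=> [v hv|_ [v hv <-]].
  by exists v => //; rewrite /sgn expr0 scale1r mul1mx.
by rewrite /sgn expr0 scale1r mul1mx.
Qed.

Lemma vface_opp_chamber :
  @vface R D [set - v | v in @fund_face R D finset.set0].
Proof.
exists true, 1%:M, finset.set0; split; first exact: weyl1.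
by apply/seteqP; split=> _ [v hv <-]; exists v => //; rewrite /sgn expr1 scaleN1r mul1mx.
Qed.

Lemma face_face_at x Fv : vface Fv -> face g (face_at g x Fv).
Proof. by exists x, Fv. Qed.

(* The germ is based at the special point [0], so that the walls through [0]
   cut the chimney down to the sector-face. *)
Lemma germ_chimney (J : {set I}) :
  germ J = chimney_germ g (face_at g 0 V0) (fund_face J).
Proof.
apply/seteqP; split=> E.
  (* The added 1 makes up for the rounding below: the floor of [ev (al i) u + 1] exceeds
     [ev (al i) u]. *)
  move=> /germP[u hu h]; have [p1 hp1] := interpolate
    (fun i => if i \in J then 0 else ev (al i) u + 1).
  have cp1 : fund_face J p1.
    move=> i; rewrite hp1; have := hu i.
    by case: (i \in J) => //; lra.
  exists p1; first exact: subset_closure.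
  (* Only the roots nonnegative on the face bound the chimney. For [i] in [J] both [al i] and
     [- al i] are among them, which forces the equality [ev (al i) x = 0]. *)
  pose nneg (a : Defs.form R D) := `[< forall p, cface J p -> 0 <= ev a p >].
  pose k a := if nneg a then Some (- Num.floor (ev a p1)) else None.
  exists k; split.
    pose k0 a := if nneg a then Some (0 : int) else None.
    exists [set x + p1 | x in hull k0].
      exists (hull k0).
        apply: hull_face_at => a _; rewrite /k0.
        by case: (nneg a); rewrite //= ev0r addr0.
      by move=> _ [x hx [_ -> <-]]; exists x.
    move=> _ [_ [x hx <-] [p hp <-]] a ra; have := hx a ra; rewrite /k0 /k.
    case e: (nneg a) => //=; rewrite addr0 => ax.
    have /asboolP/(_ _ (fund_face_cface hp)) ap := e.
    by have := Num.Theory.floor_le (ev a p1); rewrite !evDr intrN; lra.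
  move=> x hx; rewrite -[x](subrK u) addrC; apply: h => i; rewrite evBr.
  have nn : nneg (al i) by apply/asboolP => p /cface_dom.
  have := hx _ (sroot_all_root i); rewrite /k nn /= hp1 => xi.
  have := hu i; case: ifP xi => iJ xi ui.
    have nn' : nneg (- al i).
      by apply/asboolP => p /(_ i); rewrite iJ evNl => ->; rewrite oppr0.
    have := hx _ (opp_sroot_all_root i); rewrite /k nn' /= !evNl hp1 iJ.
    by rewrite oppr0 floor0 oppr0 addr0; move: xi; rewrite floor0 oppr0 addr0; lra.
  by have := floorD1_gt (ev (al i) u + 1); move: xi; rewrite intrN intrD; lra.
move=> [u]; rewrite closure_fund_face => hu [k [[E1 [E2 hE2 sub12] sub1] sub]].
have [p0 hp0] := fund_face_nonempty R J; apply/germP; exists (u + p0).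
  by rewrite addrC; exact: fund_face_add.
move=> p hp; apply/sub/sub1; exists u.
  apply: sub12; exists 0; first exact: face_at_point hE2.
  by exists u => //; rewrite add0r.
by exists (p0 + p); [exact: fund_face_add | rewrite addrA].
Qed.

End Germs.

(** * Charts centred at a sector-germ *)

Section Charts.
Context (R : realType) (D : root_datum) (g : km_algebra R[i] (@rd_cartan D)).
Context (T : Type) (M : apartment_system R D T) (hM : is_masure g M).
Local Notation I := (rd_idx D).
Local Notation V := (model R D).
Local Notation al := (@sroot R D).
Local Notation co := (@scoroot R D).
Local Notation mat := 'M[R]_(rd_rank D).
Local Notation lattice := (@coroot_lattice R D).
Local Notation sector := (@germ R D finset.set0).
Local Notation C := (@fund_face R D finset.set0).
Local Notation V0 := (@fund_face R D [set: I]%SET).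

Lemma coroot_latticeD u v : lattice u -> lattice v -> lattice (u + v).
Proof.
move=> [a ->] [b ->]; exists (fun i => a i + b i); rewrite -big_split /=.
by apply: eq_bigr => i _; rewrite intrD scalerDl.
Qed.

Lemma coroot_latticeN u : lattice u -> lattice (- u).
Proof.
move=> [a ->]; exists (fun i => - a i); rewrite -sumrN.
by apply: eq_bigr => i _; rewrite intrN scaleNr.
Qed.

Lemma coroot_lattice0 : lattice 0.
Proof. by exists (fun=> 0); rewrite big1 // => i _; rewrite scale0r. Qed.

Lemma coroot_int u i : lattice u -> exists z : int, ev (al i) u = z%:~R.
Proof.
move=> [a ->]; exists (\sum_j a j * rd_cartan j i).
rewrite /ev mulmx_sumr summxE rmorph_sum; apply: eq_bigr => j _.
by rewrite -/(ev _ _) evZr root_coroot -intrM.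
Qed.

Lemma coroot_lattice_weyl (w : mat) u : weyl w -> lattice u -> lattice (w *m u).
Proof.
move=> [s ->]; elim: s u => [|i s IH] u hu /=; first by rewrite mul1mx.
rewrite -mulmxA refl_mul; have [z ->] := coroot_int i (IH _ hu).
apply: coroot_latticeD; first exact: IH.
exists (fun j => - (z *+ (j == i))); rewrite (bigD1 i) //= eqxx big1 ?addr0.
  by rewrite intrN scaleNr.
by move=> j /negbTE ->; rewrite oppr0 scale0r.
Qed.

Lemma aff_comp (w w' : mat) (v v' x : V) :
  aff w v (aff w' v' x) = aff (w *m w') (w *m v' + v) x.
Proof. by rewrite /aff mulmxDr mulmxA addrA. Qed.

Lemma aff_inverse (w : mat) (v : V) : weyl w -> lattice v ->
  exists w' v', [/\ weyl w', lattice v',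
    cancel (aff w v) (aff w' v') & cancel (aff w' v') (aff w v)].
Proof.
move=> ww lv; have [w' ww' [w'w ww1]] := weyl_inverse ww.
exists w', (- (w' *m v)); split=> //.
- by apply/coroot_latticeN/coroot_lattice_weyl.
- by move=> x; rewrite /aff mulmxDr mulmxA w'w mul1mx addrK.
- by move=> x; rewrite /aff mulmxDr mulmxA ww1 mul1mx mulmxN mulmxA ww1 mul1mx subrK.
Qed.

Lemma isom_ex A : apt M A -> exists f, isomw M A f.
Proof.
move=> /(masure_MA1 hM)[f0 _ ->]; exists (f0 \o aff 1%:M 0), (aff 1%:M 0) => //.
by exists 1%:M, 0; split=> //; [exact: weyl1 | exact: coroot_lattice0].
Qed.

Lemma isom_comp A f (w : mat) v : apt M A -> isomw M A f -> weyl w -> lattice v ->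
  isomw M A (f \o aff w v).
Proof.
move=> /(masure_MA1 hM)[f0 _ ->] [_ [w' [v' [ww' lv' ->]]] <-] ww lv.
exists (aff (w' *m w) (w' *m v + v')); last first.
  by apply/funext => x; rewrite /= aff_comp.
exists (w' *m w), (w' *m v + v'); split=> //; first exact: weylM.
by apply: coroot_latticeD => //; exact: coroot_lattice_weyl.
Qed.

Lemma isom_diff A f f' : apt M A -> isomw M A f -> isomw M A f' ->
  exists w v, [/\ weyl w, lattice v & f' = f \o aff w v].
Proof.
move=> /(masure_MA1 hM)[f0 _ ->] [_ [w1 [v1 [ww1 lv1 ->]]] <-].
move=> [_ [w2 [v2 [ww2 lv2 ->]]] <-].
have [w' [v' [ww' lv' K1 K2]]] := aff_inverse ww1 lv1.
exists (w' *m w2), (w' *m v2 + v'); split; first exact: weylM.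
  by apply: coroot_latticeD => //; exact: coroot_lattice_weyl.
by apply/funext => x; rewrite /= -aff_comp K2.
Qed.

Lemma isom_in A f x : apt M A -> isomw M A f -> A (f x).
Proof.
move=> /(masure_MA1 hM)[f0 [f0in _ _] ->] [h _ <-].
by apply: f0in.
Qed.

Lemma isom_inj A f : apt M A -> isomw M A f -> injective f.
Proof.
move=> /(masure_MA1 hM)[f0 [_ f0inj _] ->] [_ [w [v [ww lv ->]]] <-] x y /= e.
have [w' [v' [_ _ K _]]] := aff_inverse ww lv.
by apply: (can_inj K); apply: f0inj e; rewrite inE.
Qed.

Lemma isom_surj A f x : apt M A -> isomw M A f -> A x -> exists y, f y = x.
Proof.
move=> /(masure_MA1 hM)[f0 [_ _ f0surj] ->] [_ [w [v [ww lv ->]]] <-] /f0surj[y _ <-].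
have [w' [v' [_ _ _ K]]] := aff_inverse ww lv.
by exists (aff w' v' y); rewrite /= K.
Qed.

Lemma weyl_iso_isom A A' phi f : apt M A' -> weyl_iso M A A' phi ->
  isomw M A f -> isomw M A' (phi \o f).
Proof.
move=> aA' [_ h] fA; have [f' f'A'] := isom_ex aA'.
have [_ [w [v [ww lv ->]]] ->] := h _ _ fA f'A'.
exact: isom_comp.
Qed.

(* The definition of [encl] only says that the enclosure can be read in some
   chart, hence the Weyl group element in front of the [hull]. *)
Lemma fixes_encl A F phi f : apt M A -> isomw M A f -> fixes phi (encl g M A F) ->
  exists k (w : mat) v, [/\ weyl w, F (f @` (aff w v @^-1` hull g k)) &
    forall y, hull g k (aff w v y) -> phi (f y) = f y].
Proof.
move=> aA fA [E [f1 f1A [k [hF sub]]] fix_].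
have [w [v [ww lv ff1]]] := isom_diff aA f1A fA; exists k, w, v; split=> //.
  have [w' [v' [_ _ _ K]]] := aff_inverse ww lv.
  suff -> : f @` (aff w v @^-1` hull g k) = f1 @` (\bigcap_(a in all_root g) hspace a (k a)) by [].
  apply/seteqP; split=> [_ [y hy <-]|_ [y hy <-]].
    by exists (aff w v y) => //; rewrite ff1.
  by exists (aff w' v' y); rewrite ?ff1 /= K.
by move=> y hy; apply: fix_; rewrite ff1; apply: sub.
Qed.

Lemma face_at_up x Fv (E E' : set V) :
  face_at g x Fv E -> E `<=` E' -> face_at g x Fv E'.
Proof.
move=> [k [k' [Om [nOm h1 h2]]]] sub; exists k, k', Om; split=> //.
exact: subset_trans sub.
Qed.

Lemma face_kind A f x Fv : apt M A -> isomw M A f -> vface Fv ->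
  MA3_filter g M (fmap f (face_at g x Fv)).
Proof.
by move=> aA fA vF; left; exists A => //; exists f, (face_at g x Fv); split=> //; exists x, Fv.
Qed.

(** (MA4) asks for a face or a chimney rather than a point. (MA2) at [x] puts a hull through [x]
    into the intersection, and the minimal face at [x] lies in this hull. *)
Lemma common_face A A' x : apt M A -> apt M A' -> A x -> A' x ->
  exists F : set_system T,
    [/\ MA3_filter g M F, F A, F A' & forall E, F E -> E x].
Proof.
move=> aA aA' Ax A'x; have [f fA] := isom_ex aA.
have [y fy] := isom_surj aA fA Ax.
have [[f1 f1A [k [hF sub]]] _] : encl g M A (fmap f (globally [set y])) (A `&` A') /\
    exists2 phi, [set: T -> T] phi & weyl_iso M A A' phi /\
      fixes phi (encl g M A (fmap f (globally [set y]))).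
  apply: (masure_MA2 hM) => //; last by move=> _ -> /=; rewrite fy.
  by exists f, (globally [set y]); split=> //; constructor 1; exists y.
have [z hz f1z] := hF y erefl.
exists (fmap f1 (face_at g z V0)); split.
- exact: face_kind aA f1A (vface_fund _ _).
- by apply: (face_at_up (face_atT g z V0)) => u _; exact: isom_in aA f1A.
- by apply: (face_at_up (hull_face_at hz)) => u /sub[].
- by move=> E /face_at_point /=; rewrite f1z fy.
Qed.

Lemma chamber_tits_interior (v : V) : C v -> pm_tits_interior v.
Proof.
move=> cv; left; have [K K0 hK] := forms_bounded al.
have [e e0 he] := finite_lower_bound (f := fun i => ev (al i) v)
  (fun i => ltac:(by have := cv i; rewrite finset.in_set0)).
apply/nbhs_cVP; exists (e / K); first exact: divr_gt0.
move=> y ye; exists 1%:M, (v + y); split; [exact: weyl1 | | by rewrite mul1mx].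
rewrite closure_fund_chamber => i; rewrite evDr.
have := hK i y; have := he i; rewrite ltr_pdivlMr // mulrC in ye.
by rewrite ler_norml => ? /andP[? _]; lra.
Qed.

Lemma sector_splayed A f : apt M A -> isomw M A f ->
  kind M (splayed_chimney_germ g) (fmap f sector).
Proof.
move=> aA fA; exists A => //; exists f, sector; split=> //.
exists (face_at g 0 V0), C; split; [|exact: vface_fund|exact: germ_chimney|].
  by apply: face_face_at; exact: vface_fund.
have [p hp] := fund_face_nonempty R (finset.set0 : {set I}).
by exists p; split=> //; exact: chamber_tits_interior.
Qed.

(** The support of the sector is the whole model, so only the identity fixes its direction
    pointwise. *)
Lemma sector_solid A f : apt M A -> isomw M A f ->
  MA3_filter g M (fmap f sector).
Proof.
move=> aA fA; right; exists A => //; exists f, sector; split=> //.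
exists (face_at g 0 V0), C; split; [|exact: vface_fund|exact: germ_chimney|].
  by apply: face_face_at; exact: vface_fund.
apply: (@sub_finite_set _ _ [set 1%:M]) => // w [ww] hw /=.
apply: mulmx_ext => v; rewrite mul1mx; apply: hw.
suff h x : Defs.support (chimney g (face_at g 0 V0) C) x by exists 0, v; rewrite subr0.
move=> S [[a [U ->]] [k [[E hE sub1] sub2]]] /=.
have inS p : C p -> p - a \in U.
  move=> hp; apply: sub2; apply: sub1; exists 0; first exact: face_at_point hE.
  by exists p => //; rewrite add0r.
have [u hu hux] := dominant_shift x; rewrite -fund_face0 in hu hux.
(* The point [x] is an affine combination of the chamber points [u + x], [u] and [u + u]. *)
have -> : x - a = (u + x - a) - (u - a) + (u - a) - (u + u - a) + (u - a).
  by apply/matrixP => i j; rewrite !mxE; ring.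
have hu2 : C (u + u) by apply: fund_face_add => //; exact: fund_face_cface.
by rewrite memvD ?inS // memvB ?inS // memvD ?inS // memvB ?inS.
Qed.

(** The isomorphism of (MA4), composed with [f], is a chart of [A']. It agrees with [f] on a hull
    that belongs to the sector-germ and contains an element of [F]. *)
Lemma MA4_chart A A' f (F : set_system T) : apt M A -> apt M A' -> isomw M A f ->
  fmap f sector A' -> MA3_filter g M F -> F A -> F A' ->
  exists f', isomw M A' f' /\ exists k (w : mat) v, [/\ weyl w,
    sector (aff w v @^-1` hull g k),
    exists2 E, F E & E `<=` f @` (aff w v @^-1` hull g k)
    & forall y, hull g k (aff w v y) -> f' y = f y].
Proof.
move=> aA aA' fA sA' kF FA FA'.
have sA : fmap f sector A by apply: (germ_sub (germT _ _)) => x _; exact: isom_in aA fA.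
have [phi _ [wphi fixphi]] := masure_MA4 hM aA aA' (sector_splayed aA fA) kF sA FA sA' FA'.
exists (phi \o f); split; first exact: weyl_iso_isom aA' wphi fA.
have [k [w [v [ww [E1 [E2 [hE1 hE2 EE]]] fx]]]] := fixes_encl aA fA fixphi.
exists k, w, v; split=> //.
  apply: (germ_sub hE1) => x hx.
  have [y hy /(isom_inj aA fA) <- //] : (f @` (aff w v @^-1` hull g k)) (f x).
  by rewrite EE; left.
by exists E2 => //; rewrite EE => x; right.
Qed.

(** A chart centred at [s]: in it, translation by [u] towards [s] is the addition of [u], by
    [chart_splus] and [splus_chart]. *)
Definition chart (s : set_system T) (A : set T) (f : V -> T) : Prop :=
  [/\ apt M A, isomw M A f & fmap f sector = s].

Lemma fmap_eq_on (f f' : V -> T) (E : set V) : sector E ->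
  (forall x, E x -> f' x = f x) -> fmap f' sector = fmap f sector.
Proof.
move=> hE ff'; apply/seteqP; split=> P hP /=.
  by apply: (germ_sub (germI hE hP)) => x [/ff' /= <-].
by apply: (germ_sub (germI hE hP)) => x [/ff' /= ->].
Qed.

(** Both apartments contain the germ, hence have a common point; a face at this point allows (MA4)
    to be applied. *)
Lemma chart_transfer s A f B : chart s A f -> apt M B -> s B ->
  exists f', chart s B f'.
Proof.
move=> [aA fA <-] aB sB; have [u Bfu _] := germ_nonempty sB.
have [F [kF FA FB _]] := common_face aA aB (isom_in u aA fA) Bfu.
have [f' [f'B [k [w [v [_ hZ _ e]]]]]] := MA4_chart aA aB fA sB kF FA FB.
by exists f'; split=> //; exact: fmap_eq_on hZ e.
Qed.

Lemma chart_face s A f A' f' y Fv : chart s A f -> apt M A' -> isomw M A' f' ->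
  vface Fv -> exists B fB, chart s B fB /\ fmap f' (face_at g y Fv) B.
Proof.
move=> cf aA' f'A' vF; have [aA fA es] := cf.
have := sector_splayed aA fA; rewrite es => sp.
have [B [aB sB FB]] := masure_MA3 hM sp (face_kind y aA' f'A' vF).
by have [fB cB] := chart_transfer cf aB sB; exists B, fB.
Qed.

Lemma chart_cover s A f x : chart s A f -> exists B fB y, chart s B fB /\ fB y = x.
Proof.
move=> cf; have [A' aA' A'x] := masure_cover hM x.
have [f' f'A'] := isom_ex aA'; have [y' f'y'] := isom_surj aA' f'A' A'x.
have [B [fB [cB FB]]] := chart_face y' cf aA' f'A' (vface_fund R [set: I]%SET).
have /= Bx := face_at_point FB.
have [aB fBB _] := cB; rewrite f'y' in Bx; have [y fy] := isom_surj aB fBB Bx.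
by exists B, fB, y.
Qed.

Lemma chart_meet s A f A' f' : chart s A f -> chart s A' f' ->
  exists y y', f y = f' y'.
Proof.
move=> [aA fA <-] [aA' f'A' e].
have : fmap f' sector A' by apply: (germ_sub (germT _ _)) => x _; exact: isom_in aA' f'A'.
rewrite e => /germ_nonempty[y A'fy _].
by have [y' f'y'] := isom_surj aA' f'A' A'fy; exists y, y'.
Qed.

(* [x +_s u] does not depend on the chart. *)
Lemma chart_add s A f A' f' y y' u : chart s A f -> chart s A' f' ->
  f y = f' y' -> dom u -> f (y + u) = f' (y' + u).
Proof.
move=> [aA fA es] [aA' f'A' es'] yy' du.
have sA' : fmap f sector A'.
  by rewrite es -es'; apply: (germ_sub (germT _ _)) => x _; exact: isom_in aA' f'A'.
have A'fy : A' (f y) by rewrite yy'; exact: isom_in aA' f'A'.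
have [F [kF FA FA' Fy]] := common_face aA aA' (isom_in y aA fA) A'fy.
have [f1 [f1A' [k [w [v [ww hZ [E /Fy Ey sub] e]]]]]] := MA4_chart aA aA' fA sA' kF FA FA'.
have [y0 hy0 /(isom_inj aA fA) ey] := sub _ Ey; rewrite {y0}ey in hy0.
have /germP[u0 _ hu0] := hZ.
(* The hull contains [y] and a sector, hence the closed chamber based at [y]. *)
have e1 p : dom p -> f1 (y + p) = f (y + p).
  by move=> dp; apply: e; apply: (hull_cone hy0 hu0); rewrite cface0.
(* Both [f1] and [f'] are charts of [A'] centred at [s]. Their linear difference [w1] maps a point
   of the open chamber to a dominant vector, so it is trivial. *)
have [w1 [v1 [ww1 _ f1E]]] := isom_diff aA' f'A' f1A'.
have h1 : sector (aff w1 v1 @^-1` C).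
  have : fmap f1 sector (f' @` C).
    rewrite (fmap_eq_on hZ e) es -es' /=; have [p hp] := fund_face_nonempty R (finset.set0 : {set I}).
    by apply/germP; exists p => // q hq; exists (p + q) => //; exact: fund_face_add.
  rewrite f1E => h; apply: (germ_sub h) => x /= [z hz /(isom_inj aA' f'A') <-].
  exact: hz.
have [p hp dwp] := germ_stable_weyl ww1 h1.
rewrite fund_face0 in hp; have w1E := chamber_face_weyl ww1 hp dwp.
have f1t x : f1 x = f' (x + v1) by rewrite f1E w1E /= /aff mul1mx.
have d0 : dom (0 : V) by move=> i; rewrite ev0r.
have : f1 (y + 0) = f (y + 0) by exact: e1.
rewrite !addr0 f1t yy' => /(isom_inj aA' f'A') ey.
by rewrite -(e1 u du) f1t -ey addrAC.
Qed.

End Charts.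

(** * Equivalence of norms in finite dimension *)

Section NormEquivalence.
Context (R : realType) (n : nat) (N : 'cV[R]_n -> R).
Context (ND : forall x y, N (x + y) <= N x + N y)
  (NZ : forall (a : R) x, N (a *: x) = `|a| * N x)
  (N_eq0 : forall x, N x = 0 -> x = 0).

Lemma seminorm0 : N 0 = 0.
Proof. by rewrite -(scale0r (0 : 'cV[R]_n)) NZ normr0 mul0r. Qed.

Lemma seminormN x : N (- x) = N x.
Proof. by rewrite -scaleN1r NZ normrN normr1 mul1r. Qed.

Lemma seminorm_ge0 x : 0 <= N x.
Proof. by have := ND x (- x); rewrite subrr seminorm0 seminormN; lra. Qed.

Lemma seminorm_le : exists2 K : R, 0 < K & forall x, N x <= K * `|x|.
Proof.
pose e k : 'cV[R]_n := delta_mx k 0.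
exists (1 + \sum_k N (e k)).
  by rewrite ltr_pwDl // sumr_ge0 // => k _; exact: seminorm_ge0.
move=> x; have {1}-> : x = \sum_k x k 0 *: e k.
  rewrite [LHS]matrix_sum_delta; apply: eq_bigr => k _.
  by rewrite big_ord1.
have sumN (s : seq 'I_n) : N (\sum_(k <- s) x k 0 *: e k) <= \sum_(k <- s) N (x k 0 *: e k).
  elim: s => [|k s IH]; first by rewrite !big_nil seminorm0.
  by rewrite !big_cons (le_trans (ND _ _)) // lerD2l.
rewrite (le_trans (sumN _)) // mulrDl mul1r -[leLHS]add0r lerD // mulr_suml.
by rewrite ler_sum // => k _; rewrite NZ mulrC ler_wpM2l ?seminorm_ge0 ?entry_le_norm.
Qed.

Lemma norm_trmx_le m p (x : 'M[R]_(m, p)) : `|x^T| <= `|x|.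
Proof.
rewrite [leLHS]/Num.Def.normr /= mx_normrE; apply: bigmax_le => // -[i j] _ /=.
rewrite [leRHS]/Num.Def.normr /= mx_normrE; apply/bigmax_geP; right => /=.
by exists (j, i) => //=; rewrite mxE.
Qed.

(** By compactness [N] has a minimum on the unit sphere, positive by [N_eq0]. Transposition passes
    to the row vectors of [EVT_min_rV]. *)
Lemma norm_equivalent : exists2 c : R, 0 < c & forall x, `|x| <= c * N x.
Proof.
have [K K0 hK] := seminorm_le.
have normT (x : 'cV[R]_n) : `|x^T| = `|x|.
  by apply/le_anti; rewrite norm_trmx_le -{1}[x]trmxK norm_trmx_le.
have unitT (x : 'cV[R]_n) : x != 0 -> `| `|x|^-1 *: x^T : 'rV[R]_n| = 1.
  by move=> x0; rewrite mx_normZ normT normfV normr_id mulVf // normr_eq0.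
pose F (r : 'rV[R]_n) := N r^T.
pose S := [set r : 'rV[R]_n | `|r| = 1].
have Fc : continuous F.
  move=> r A /nbhs_ballP[e /= e0 hA]; apply/nbhs_ballP.
  exists (e / K) => [|r']; first exact: divr_gt0.
  rewrite -ball_normE /= ltr_pdivlMr // mulrC => h; apply: hA.
  rewrite -ball_normE /=; apply: le_lt_trans h.
  have lip a b : N a - N b <= N (a - b).
    by have := ND (a - b) b; rewrite subrK; lra.
  have l1 : N (r - r')^T <= K * `|r - r'|.
    by rewrite (le_trans (hK _)) // ler_wpM2l ?norm_trmx_le // ltW.
  have l2 := lip r^T r'^T; have l3 := lip r'^T r^T.
  rewrite -(seminormN (r'^T - r^T)) opprB in l3; rewrite -linearB /= in l2 l3.
  by rewrite ler_norml /F; apply/andP; split; lra.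
have Sc : compact S.
  apply: bounded_closed_compact.
    by exists 1; split=> // b b1 r /= ->; exact: ltW.
  apply: (@closed_comp _ _ (fun r : 'rV[R]_n => `|r|) [set 1]).
    by move=> r _; exact: norm_continuous.
  exact: closed_eq.
case: (pselect (S !=set0)) => [S0|noS]; last first.
  exists 1 => // x; suff -> : x = 0 by rewrite normr0 mul1r seminorm_ge0.
  by apply: contra_notP noS => /eqP x0; exists (`|x|^-1 *: x^T); exact: unitT.
have [r0 /set_mem Sr0 hr0] := EVT_min_rV S0 Sc (continuous_subspaceT Fc).
have m0 : 0 < F r0.
  rewrite lt_neqAle seminorm_ge0 andbT eq_sym; apply/eqP => /N_eq0/eqP.
  rewrite trmx_eq0 => /eqP r00; move: Sr0; rewrite /S /= r00 normr0 => /eqP.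
  by rewrite eq_sym oner_eq0.
exists (F r0)^-1; first by rewrite invr_gt0.
move=> x; have [->|x0] := eqVneq x 0; first by rewrite normr0 seminorm0 mulr0.
have nx : 0 < `|x| by rewrite normr_gt0.
have /hr0 : `|x|^-1 *: x^T \in S.
  by rewrite inE; exact: unitT.
rewrite {2}/F linearZ /= trmxK NZ normfV normr_id !ler_pdivlMl //.
by rewrite mulrC.
Qed.

End NormEquivalence.

(** * The distances *)

Section Distance.
Context (R : realType) (D : root_datum) (g : km_algebra R[i] (@rd_cartan D)).
Context (T : Type) (M : apartment_system R D T) (hM : is_masure g M).
Local Notation I := (rd_idx D).
Local Notation V := (model R D).
Local Notation al := (@sroot R D).
Local Notation mat := 'M[R]_(rd_rank D).
Local Notation lattice := (@coroot_lattice R D).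
Local Notation sector := (@germ R D finset.set0).
Local Notation chart := (@chart R D T M).

Lemma weyl_unit (w : mat) : weyl w -> w \in unitmx /\ weyl (invmx w).
Proof.
move=> ww; have [w' ww' [w'w ww1]] := weyl_inverse ww.
have [u _] := mulmx1_unit ww1.
by split=> //; rewrite -[invmx w]mulmx1 -ww1 mulKmx.
Qed.

Lemma wall_image (w : mat) (v : V) (a : Defs.form R D) (k z : int) : weyl w ->
  ev (a *m invmx w) v = z%:~R ->
  aff w v @` wall a k = wall (a *m invmx w) (k - z).
Proof.
move=> /weyl_unit[uw _] av; apply/seteqP; split=> [_ [x hx <-]|y] /=.
  rewrite /wall /= /aff evDr av evMr mulKmx // intrB.
  by move: hx; rewrite /wall /=; lra.
rewrite /wall /= intrB => hy; exists (invmx w *m (y - v)).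
  by rewrite /= -evMr evBr av; lra.
by rewrite /aff mulKVmx // subrK.
Qed.

Lemma wall_coroot_affine_weyl (w : mat) (v : V) : weyl w -> lattice v ->
  forall p, wall_coroot p -> wall_coroot (aff w v @` p.1, w *m p.2).
Proof.
move=> ww lv _ [w1 [i [k [ww1 ->]]]] /=.
have [uw wi] := weyl_unit ww; have [uw1 w1i] := weyl_unit ww1.
have [z hz] : exists z : int, ev (al i *m invmx w1 *m invmx w) v = z%:~R.
  by rewrite !evMr; apply: coroot_int; do 2! apply: coroot_lattice_weyl => //.
exists (w *m w1), i, (k - z); split; first exact: weylM.
rewrite (wall_image k ww hz) mulmxA; congr (wall _ _, _).
rewrite -mulmxA; congr (_ *m _).
have uu : w *m w1 \in unitmx by rewrite unitmx_mul uw.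
apply: (can_inj (mulKmx uu)); rewrite mulmxV // -mulmxA (mulmxA w1).
by rewrite mulmxV // mul1mx mulmxV.
Qed.

(** Distances are defined with vectorially Weyl isomorphisms, charts with the affine Weyl group;
    this inclusion lets a chart serve in [is_splus]. *)
Lemma affine_weyl_vw (w : mat) (v : V) : weyl w -> lattice v ->
  @vw_aut R D (aff w v).
Proof.
move=> ww lv; split; first by exists w, v.
exists w, v; split=> //; first by have [] := weyl_unit ww.
apply/seteqP; split=> [_ [p hp <-]|p hp]; first exact: wall_coroot_affine_weyl.
have [w' ww' [w'w ww1]] := weyl_inverse ww.
have lv' : lattice (- (w' *m v)).
  by apply/coroot_latticeN/coroot_lattice_weyl.
exists (aff w' (- (w' *m v)) @` p.1, w' *m p.2).
  exact: wall_coroot_affine_weyl.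
rewrite /= mulmxA ww1 mul1mx image_comp; case: p hp => p1 p2 _ /=; congr pair.
rewrite -[RHS]image_id; apply: eq_imagel => x _ /=.
by rewrite aff_comp /aff ww1 mul1mx mulmxN mulmxA ww1 mul1mx addNr addr0.
Qed.

Lemma chart_splus s A f y u : chart s A f -> is_splus M false s (f y) u (f (y + u)).
Proof.
move=> [aA fA fs]; exists A, f, y; split=> //.
- exact: (isom_in hM _ aA fA).
- by rewrite -fs; apply: (germ_sub (germT _ _)) => x _; exact: (isom_in hM _ aA fA).
- split.
    split=> [x _|x x' _ _|x Ax].
    + exact: (isom_in hM _ aA fA).
    + exact: (isom_inj hM aA fA).
    + by have [z hz] := isom_surj hM aA fA Ax; exists z.
  move=> f' f'A; have [w [v [ww lv ->]]] := isom_diff hM aA f'A fA.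
  by exists (aff w v) => //; exact: affine_weyl_vw.
- by rewrite pm_inftyE fs /sgn expr0 scale1r.
Qed.

(** The map [psi] is a chart up to a translation that may lie outside the coroot lattice. The base
    point absorbs this translation, and the germ is unchanged by [germ_translate]. *)
Lemma splus_chart s x u z : is_splus M false s x u z ->
  exists A f y, [/\ chart s A f, f y = x & z = f (y + u)].
Proof.
move=> [A [psi [y [aA Ax sA [_ hpsi] [psis psiy ->]]]]].
have [f fA] := isom_ex hM aA.
have [_ [[w [v [ww _ ->]]] _] psiE] := hpsi f fA.
have [w' ww' [w'w ww1]] := weyl_inverse ww.
have psiE' t : psi t = f (w *m (t + w' *m v) + 0).
  by rewrite psiE /= /aff mulmxDr mulmxA ww1 mul1mx addr0.
exists A, (f \o aff w 0), (y + w' *m v); split.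
- split=> //; first exact: (isom_comp hM aA fA ww (coroot_lattice0 _ _)).
  rewrite -psis pm_inftyE; apply/seteqP; split=> E /=.
    move=> /(germ_translate (w' *m v)) h; apply: (germ_sub h) => t /=.
    by rewrite psiE'.
  move=> h; apply/(germ_translate (w' *m v)); apply: (germ_sub h) => t /=.
  by rewrite psiE'.
- by rewrite -psiy psiE'.
- by rewrite psiE' /= /aff /sgn expr0 scale1r addrAC.
Qed.

Lemma U_pairsP s x x' p : U_pairs M false s x x' p <->
  [/\ dom p.1, dom p.2 & exists A f y A' f' y',
    [/\ chart s A f, chart s A' f', f y = x, f' y' = x'
      & f (y + p.1) = f' (y' + p.2)]].
Proof.
rewrite /U_pairs /= closure_fund_chamber; split.
  move=> [d1 d2 [z /splus_chart[A [f [y [c1 <- ->]]]]]].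
  move=> /splus_chart[A' [f' [y' [c2 <- e]]]].
  by split=> //; exists A, f, y, A', f', y'; split.
move=> [d1 d2 [A [f [y [A' [f' [y' [c1 c2 <- <- e]]]]]]]]; split=> //.
by exists (f (y + p.1)); [exact: (chart_splus _ _ c1) | rewrite e; exact: (chart_splus _ _ c2)].
Qed.

Lemma dominating (J : finType) (v : J -> V) :
  exists c : V, forall j, @fund_chamber R D (c - v j).
Proof.
have [c hc] := interpolate (fun i => \sum_j `|ev (al i) (v j)| + 1).
exists c => j i; rewrite evBr hc (bigD1 j) //=.
have h1 : 0 <= \sum_(k | k != j) `|ev (al i) (v k)| by rewrite sumr_ge0.
by have := ler_norm (ev (al i) (v j)); lra.
Qed.

(** Two charts centred at [s] meet at some [f z = f' z']; both points are pushed to [f (z + c)] for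
    [c] dominant enough. *)
Lemma U_pairs_nonempty s A0 f0 x x' : chart s A0 f0 ->
  U_pairs M false s x x' !=set0.
Proof.
move=> c0; have [A [f [y [cf <-]]]] := chart_cover hM x c0.
have [A' [f' [y' [cf' <-]]]] := chart_cover hM x' c0.
have [z [z' e]] := chart_meet hM cf cf'.
have [c hc] := dominating (fun j : 'I_3 => nth 0 [:: 0; y - z; y' - z'] j).
have c0' : dom c by move=> i; apply/ltW; have := hc ord0 i; rewrite subr0.
exists (z + c - y, z' + c - y'); apply/U_pairsP; split=> /=.
- move=> i; apply/ltW; have := hc (inord 1) i; rewrite inordK //=.
  by rewrite !(evDr, evNr); lra.
- move=> i; apply/ltW; have := hc (inord 2) i; rewrite inordK //=.
  by rewrite !(evDr, evNr); lra.
- exists A, f, y, A', f', y'; split=> //.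
  by rewrite ![_ + (_ - _)]addrC !subrK; exact: (chart_add hM cf cf').
Qed.

Context (N : V -> R) (hN : is_norm N).
Local Notation dist s := (dist M false (N, s)).

Let ND := norm_triangle hN.
Let NZ := norm_scale hN.
Let N_ge0 := seminorm_ge0 ND NZ.

Lemma dist_le s x x' p : U_pairs M false s x x' p -> dist s x x' <= N p.1 + N p.2.
Proof.
move=> hp; apply: ge_inf; last by exists p.
by exists 0 => _ [q _ <-]; rewrite addr_ge0.
Qed.

Lemma dist_glb s A f x x' e : chart s A f ->
  (forall p, U_pairs M false s x x' p -> e <= N p.1 + N p.2) -> e <= dist s x x'.
Proof.
move=> cf h; apply: lb_le_inf; last by move=> _ [p hp <-]; exact: h.
have [p hp] := U_pairs_nonempty x x' cf.
by exists (N p.1 + N p.2); exists p.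
Qed.

Lemma dist_adherent s A f x x' e : chart s A f -> 0 < e ->
  exists2 p, U_pairs M false s x x' p & N p.1 + N p.2 < dist s x x' + e.
Proof.
move=> cf e0.
have hinf : has_inf [set N p.1 + N p.2 | p in U_pairs M false s x x'].
  have [p hp] := U_pairs_nonempty x x' cf.
  split; first by exists (N p.1 + N p.2); exists p.
  by exists 0 => _ [q _ <-]; rewrite addr_ge0.
by have [_ [p hp <-] h] := inf_adherent e0 hinf; exists p.
Qed.

(** Nearly optimal pairs [p] for [x], [y] and [q] for [y], [z] combine into
    [(p.1 + q.1, q.2 + p.2)], because dominant translations towards [s] commute. *)
Lemma dist_triangle s A f x y z : chart s A f ->
  dist s x z <= dist s x y + dist s y z.
Proof.
move=> cf; apply/ler_addgt0Pr => e e0; have e2 : 0 < e / 2 by lra.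
have [p /U_pairsP[dp1 dp2 [A1 [f1 [y1 [A2 [f2 [y2 [c1 c2 h1 h2 e12]]]]]]]] hp] :=
  dist_adherent x y cf e2.
have [q /U_pairsP[dq1 dq2 [A3 [f3 [y3 [A4 [f4 [y4 [c3 c4 h3 h4 e34]]]]]]]] hq] :=
  dist_adherent y z cf e2.
have dD a b : dom a -> dom b -> @dom R D (a + b).
  by move=> ha hb i; rewrite evDr addr_ge0.
have : U_pairs M false s x z (p.1 + q.1, q.2 + p.2).
  apply/U_pairsP; split=> /=; [exact: dD | exact: dD|].
  exists A1, f1, y1, A4, f4, y4; split=> //.
  rewrite addrA (chart_add hM c1 c2 e12 dq1) -addrA.
  have e23 : f2 y2 = f3 y3 by rewrite h2 h3.
  rewrite (chart_add hM c2 c3 e23 (dD _ _ dp2 dq1)) addrA addrAC.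
  by rewrite (chart_add hM c3 c4 e34 dp2) addrA.
move=> /dist_le /= h; have := ND p.1 q.1; have := ND q.2 p.2; lra.
Qed.

Lemma dist_sym s A f x y : chart s A f -> dist s x y = dist s y x.
Proof.
suff h x' y' : chart s A f -> dist s x' y' <= dist s y' x'.
  by move=> cf; apply/le_anti; rewrite !h.
move=> cf; apply: (dist_glb cf) => p.
move=> /U_pairsP[d1 d2 [A1 [f1 [y1 [A2 [f2 [y2 [c1 c2 h1 h2 e12]]]]]]]].
rewrite addrC -[p.1]/((p.2, p.1).2) -[p.2]/((p.2, p.1).1).
apply: dist_le; apply/U_pairsP; split=> //=.
by exists A2, f2, y2, A1, f1, y1; split.
Qed.

(** Within one chart centred at [s], every admissible pair satisfies [x + p.1 = y + p.2]. *)
Lemma dist_chart_ge s A f x y : chart s A f -> N (x - y) <= dist s (f x) (f y).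
Proof.
move=> cf; apply: dist_glb (cf) _ => p.
move=> /U_pairsP[d1 d2 [A1 [f1 [y1 [A2 [f2 [y2 [c1 c2 h1 h2 e12]]]]]]]].
have : f (x + p.1) = f (y + p.2).
  rewrite (chart_add hM cf c1 (esym h1) d1) e12.
  by rewrite (chart_add hM cf c2 (esym h2) d2).
have [aA fA _] := cf; move=> /(isom_inj hM aA fA) e.
have -> : x - y = p.2 - p.1.
  by rewrite -[x](addrK p.1) e addrAC [y + _]addrC addrK.
by rewrite (le_trans (ND _ _)) // (seminormN NZ) addrC.
Qed.

(** Adding [t *: rho], where all simple roots are 1 at [rho] and [t] is proportional to the norm of
    [v], makes [v] dominant. As [v != 0], [t] is positive and both terms lie in the open chamber. *)
Lemma small_dominant_decomposition :
  exists2 K : R, 0 < K & forall v : V, v != 0 -> exists u u',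
    [/\ @fund_chamber R D u, @fund_chamber R D u', v = u - u' &
        N u + N u' <= K * `|v|].
Proof.
have [K1 K10 hK1] := seminorm_le ND NZ.
have [K2 K20 hK2] := forms_bounded al.
have [rho hrho] := interpolate (fun _ : I => 1 : R).
have rho0 := N_ge0 rho.
exists (K1 + 4 * K2 * (N rho + 1)) => [|v v0].
  by rewrite addr_gt0 // !mulr_gt0 //; lra.
have nv : 0 < `|v| by rewrite normr_gt0.
pose t := 2 * K2 * `|v|; have t0 : 0 < t by rewrite !mulr_gt0.
exists (v + t *: rho), (t *: rho); split.
- move=> i; rewrite evDr evZr hrho; have := hK2 i v.
  by rewrite ler_norml /t => /andP[h _]; nra.
- by move=> i; rewrite evZr hrho mulr1.
- by rewrite addrK.
- have := ND v (t *: rho); rewrite NZ (gtr0_norm t0); have := hK1 v; rewrite /t.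
  nra.
Qed.

Lemma dist_chart_le : exists2 K : R, 0 < K & forall s A f x y, chart s A f ->
  dist s (f x) (f y) <= K * `|x - y|.
Proof.
have [K K0 hK] := small_dominant_decomposition; exists K => // s A f x y cf.
have [e|yx] := eqVneq (y - x) 0.
  have -> : y = x by apply/eqP; rewrite -subr_eq0 e.
  rewrite subrr normr0 mulr0.
  suff /dist_le : U_pairs M false s (f x) (f x) (0, 0).
    by rewrite /= (seminorm0 NZ) addr0.
  by apply/U_pairsP; split=> /=; [move=> i; rewrite ev0r..|exists A, f, x, A, f, x; split].
have [u [u' [du du' e h]]] := hK _ yx.
suff /dist_le : U_pairs M false s (f x) (f y) (u, u').
  by move=> /le_trans; apply; rewrite distrC.
apply/U_pairsP; split=> /=; [by move=> i; exact/ltW..|].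
exists A, f, x, A, f, y; split=> //; congr f.
by rewrite -[y](subrK x) e addrAC [_ + x]addrC subrK addrC.
Qed.

End Distance.

(** Let [m] be the supremum of the [t] up to which [P] holds throughout. The limit hypothesis gives
    [P m], and for [m < b] the step hypothesis would go past [m]. *)
Lemma real_induction (R : realType) (b : R) (P : R -> Prop) : P 0 ->
  (forall t, 0 <= t -> t < b -> P t ->
    exists2 e, 0 < e & forall t', t < t' -> t' < t + e -> t' <= b -> P t') ->
  (forall t, 0 < t -> t <= b -> (forall t', 0 <= t' -> t' < t -> P t') -> P t) ->
  forall t, 0 <= t -> t <= b -> P t.
Proof.
move=> P0 Pstep Plim t0 t00 t0b.
pose S := [set t | [/\ 0 <= t, t <= b & forall t', 0 <= t' -> t' <= t -> P t']].
have S0 : S 0.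
  split=> //; first exact: le_trans t0b.
  by move=> t' h1 h2; have -> : t' = 0 by apply/le_anti; rewrite h1 h2.
have supS : has_sup S by split; [exists 0 | exists b => t []].
pose m := sup S; have m0 : 0 <= m by apply: ub_le_sup => //; case: supS.
have mb : m <= b by apply: ge_sup => [|t []]; first by exists 0.
have below t : 0 <= t -> t < m -> P t.
  move=> tt0; rewrite -subr_gt0 => tm.
  have [z [_ _ h] th] := sup_adherent tm supS.
  by apply: h => //; move: th; rewrite -/m; lra.
have Pm : P m.
  have [m00|] := ltP 0 m; first exact: Plim.
  by move=> h; have -> : m = 0 by apply/le_anti; rewrite h m0.
have [mb'|bm] := ltP m b; last first.
  have [tm|mt] := ltP t0 m; first exact: below.
  by have -> : t0 = m by lra.
have [e e0 he] := Pstep m m0 mb' Pm.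
pose m' := Num.min b (m + e / 2).
have mm' : m < m' by rewrite lt_min mb' /=; lra.
have : S m'.
  split; first by lra.
    by rewrite ge_min lexx.
  move=> t' h1 h2; have [h|h] := ltP t' m; first exact: below.
  have [->|h'] := eqVneq t' m; first exact: Pm.
  move: h2; rewrite le_min => /andP[h2 h3].
  by apply: he => //; [rewrite lt_neqAle eq_sym h' | lra].
by case: supS => _ bS /(ub_le_sup bS); rewrite -/m; lra.
Qed.

(** * Segments common to two apartments *)

Section Segments.
Context (R : realType) (D : root_datum) (g : km_algebra R[i] (@rd_cartan D)).
Context (T : Type) (M : apartment_system R D T) (hM : is_masure g M).
Local Notation I := (rd_idx D).
Local Notation V := (model R D).
Local Notation al := (@sroot R D).
Local Notation mat := 'M[R]_(rd_rank D).
Local Notation tits := (@tits_cone R D).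

(** (MA2) is applied to the germ of the interval open at [y], since [B] is only known to contain the
    points after [y]. Hulls are closed, so the formula extends to [t = 0]. *)
Lemma local_chart A B f f' (y d : V) (e : R) :
  apt M A -> apt M B -> isomw M A f -> isomw M B f' ->
  d != 0 -> tits d \/ tits (- d) -> 0 < e ->
  (forall t, 0 < t -> t < e -> B (f (y + t *: d))) ->
  exists (w : mat) v (e' : R), [/\ weyl w, 0 < e' & forall t, 0 <= t -> t < e' ->
    f (y + t *: d) = f' (aff w v (y + t *: d))].
Proof.
move=> aA aB fA f'B d0 td e0 hB; have nd : 0 < `|d| by rewrite normr_gt0.
pose F0 := within (segment y (y + d) `\ y) (nbhs y).
have [_ [phi _ [wphi fixphi]]] : encl g M A (fmap f F0) (A `&` B) /\
    exists2 phi, [set: T -> T] phi & weyl_iso M A B phi /\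
      fixes phi (encl g M A (fmap f F0)).
  apply: (masure_MA2 hM) => //.
    exists f, F0; split=> //; constructor 2; exists y, (y + d); split.
    - by apply: contra d0 => /eqP h; apply/eqP/(addrI y); rewrite addr0.
    - by rewrite /tits_le opprD addrA subrr sub0r addrAC subrr add0r.
    - by right.
  apply/nbhs_cVP; exists (e * `|d|); first exact: mulr_gt0.
  move=> p pe [[t t01 /esym E] ny] /=; move: E ny pe; rewrite addrAC subrr add0r.
  move=> /addrI ->; move: t01; rewrite /= in_itv /= => /andP[t0 t1] ny.
  rewrite normrZ ltr_pM2r // ger0_norm // => te; apply: hB => //.
  rewrite lt_neqAle t0 andbT eq_sym; apply/eqP => t00; apply: ny.
  by rewrite t00 scale0r addr0.
have [k [w0 [v0 [_ /nbhs_cVP[r r0 hr] fx]]]] := fixes_encl hM aA fA fixphi.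
pose e' := Num.min 1 (r / `|d|).
have e'0 : 0 < e' by rewrite lt_min ltr01 divr_gt0.
have hk t : 0 < t -> t < e' -> hull g k (aff w0 v0 (y + t *: d)).
  move=> t0; rewrite lt_min ltr_pdivlMr // => /andP[t1 tr].
  have /hr : `|t *: d| < r by rewrite normrZ gtr0_norm.
  case=> [|z hz /(isom_inj hM aA fA) <- //]; split.
    exists t; last by rewrite addrAC subrr add0r.
    by rewrite /= in_itv /= (ltW t0) ltW.
  move=> /= h; have /eqP : t *: d = 0 by apply: (addrI y); rewrite addr0.
  by rewrite scaler_eq0 (negbTE d0) gt_eqF.
have hk0 := hull_limit e'0 hk.
have [w [v [ww _ E]]] := isom_diff hM aB f'B (weyl_iso_isom hM aB wphi fA).
exists w, v, e'; split=> // t t0 te.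
rewrite -[RHS]/((f' \o aff w v) _) -E /= fx //.
have [->|tn] := eqVneq t 0; first by rewrite scale0r addr0.
by apply: hk; rewrite // lt_neqAle eq_sym tn.
Qed.

Lemma tits_scale (d : V) (t : R) : 0 <= t -> tits d -> tits (t *: d).
Proof.
move=> t0 [w [v [ww dv ->]]]; exists w, (t *: v); split=> //.
  move: dv; rewrite closure_fund_chamber => dv i.
  by rewrite evZr mulr_ge0.
by rewrite -scalemxAr.
Qed.

Lemma tits_dom (d : V) : dom d -> tits d.
Proof.
move=> dd; exists 1%:M, d; rewrite closure_fund_chamber mul1mx; split=> //.
exact: weyl1.
Qed.

Lemma weyl_neq0 (w : mat) (d : V) : weyl w -> d != 0 -> w *m d != 0.
Proof.
move=> /weyl_unit[uw _]; apply: contra => /eqP h.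
by rewrite -[d](mulKmx uw) h mulmx0.
Qed.

(** Some element of the Weyl group multiplies a nonzero dominant vector by [m1 / m2]. The
    fundamental domain property forces this ratio to be 1. *)
Lemma tits_slope_unique (w1 w2 : mat) (d d' : V) (m1 m2 : R) :
  weyl w1 -> weyl w2 -> tits d -> d != 0 -> 0 <= m1 -> 0 <= m2 ->
  w1 *m d = m1 *: d' -> w2 *m d = m2 *: d' -> m1 = m2.
Proof.
move=> ww1 ww2 [w0 [d0 [ww0]]]; rewrite closure_fund_chamber => dd0 -> wd0 m10 m20.
have [u2 w2i] := weyl_unit ww2; have [u0 w0i] := weyl_unit ww0.
have d0n : d0 != 0 by apply: contra wd0 => /eqP ->; rewrite mulmx0.
move=> e1 e2.
have m2n : m2 != 0.
  by apply: contraTneq (weyl_neq0 ww2 wd0) => m20'; rewrite e2 m20' scale0r eqxx.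
have d'E : d' = m2^-1 *: (w2 *m (w0 *m d0)).
  by rewrite e2 scalerA mulVf // scale1r.
have E : (invmx w0 *m (invmx w2 *m (w1 *m w0))) *m d0 = (m1 / m2) *: d0.
  rewrite -!mulmxA e1 d'E scalerA -!scalemxAr.
  by rewrite (mulKmx u2) (mulKmx u0).
have k0 : 0 <= m1 / m2 by rewrite divr_ge0.
have [] := dom_stabilizer (w := invmx w0 *m (invmx w2 *m (w1 *m w0))) _ dd0.
- by do 3! apply: weylM => //.
- by rewrite E => i; rewrite evZr mulr_ge0.
rewrite E -{2}[d0]scale1r => /eqP; rewrite -subr_eq0 -scalerBl scaler_eq0.
by rewrite (negbTE d0n) orbF subr_eq0 => /eqP/(canRL (divfK m2n)); rewrite mul1r.
Qed.

Section Affine.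
Context (A B : set T) (f f' : V -> T) (x y x' y' : V).
Context (aA : apt M A) (aB : apt M B) (fA : isomw M A f) (f'B : isomw M B f').
Context (fx : f x = f' x') (fy : f y = f' y') (xy : tits (y - x)).
Local Notation d := (y - x).
Local Notation d' := (y' - x').

Lemma segment_map (a b a' b' : V) t : f a = f' a' -> f b = f' b' -> tits (b - a) ->
  0 <= t -> t <= 1 ->
  exists m, [/\ 0 <= m, m <= 1 & f (a + t *: (b - a)) = f' (a' + m *: (b' - a'))].
Proof.
move=> fa fb ab t0 t1.
have E := masure_MAO hM aA aB fA f'B fa fb ab.
have : (f @` segment a b) (f (a + t *: (b - a))).
  by exists (a + t *: (b - a)) => //; exists t => //; rewrite /= in_itv /= t0.
rewrite E => -[_ [m m01 <-] <-]; exists m; move: m01.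
by rewrite /= in_itv /= => /andP[].
Qed.

(** (MAO) makes one segment a reparametrisation [m] of the other. By [local_chart], [m] has
    one-sided slopes [s] with [w *m d = s *: d']; they are all equal by [tits_slope_unique]. Real
    induction then shows that [m] is linear, and its values at the ends give the slope 1. *)
Lemma segment_affine : exists2 w : mat, weyl w & d' = w *m d /\
  forall t, 0 <= t -> t <= 1 -> f (x + t *: d) = f' (x' + t *: d').
Proof.
have [d0|dn] := eqVneq d 0.
  have yx : y = x by apply/eqP; rewrite -subr_eq0 d0.
  have y'x' : y' = x' by apply: (isom_inj hM aB f'B); rewrite -fy -fx yx.
  exists 1%:M; first exact: weyl1.
  rewrite mul1mx yx y'x' !subrr; split=> // t _ _; by rewrite !scaler0 !addr0.
have d'n : d' != 0.
  apply: contra dn; rewrite subr_eq0 => /eqP e; rewrite subr_eq0; apply/eqP.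
  by apply: (isom_inj hM aA fA); rewrite fx fy e.
have scale_inj a b : a *: d' = b *: d' -> a = b.
  move/eqP; rewrite -subr_eq0 -scalerBl scaler_eq0 (negbTE d'n) orbF subr_eq0.
  by move/eqP.
have [m hm] : exists m : R -> R, forall t, 0 <= t -> t <= 1 ->
    [/\ 0 <= m t, m t <= 1 & f (x + t *: d) = f' (x' + m t *: d')].
  have /choice[m hm] : forall t, exists mt, 0 <= t -> t <= 1 ->
      [/\ 0 <= mt, mt <= 1 & f (x + t *: d) = f' (x' + mt *: d')].
    move=> t; case: (pselect (0 <= t /\ t <= 1)) => [[t0 t1]|h].
      by have [mt h] := segment_map fx fy xy t0 t1; exists mt.
    by exists 0 => t0 t1; case: h.
  by exists m.
have mE t u : 0 <= t -> t <= 1 -> f (x + t *: d) = f' (x' + u *: d') -> m t = u.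
  move=> t0 t1; have [_ _ ->] := hm t t0 t1.
  by move=> /(isom_inj hM aB f'B)/addrI/scale_inj.
(* (MAO) on the initial segment ending at [x + u *: d]. Monotonicity makes the slopes
   nonnegative. *)
have m_mono t u : 0 <= t -> t <= u -> u <= 1 -> m t <= m u.
  move=> t0 tu u1; have [u0|un] := eqVneq u 0.
    by have -> : t = u by lra.
  have up : 0 < u by lra.
  have [mu0 mu1 fu] := hm u (ltW up) u1.
  have tu0 : 0 <= t / u by rewrite divr_ge0 // ltW.
  have tu1 : t / u <= 1 by rewrite ler_pdivrMr // mul1r.
  have tud : tits (x + u *: d - x).
    by rewrite addrAC subrr add0r; apply: tits_scale => //; exact: ltW.
  have [n [n0 n1]] := segment_map fx fu tud tu0 tu1.
  rewrite !(addrAC _ _ (- x)) !(addrAC _ _ (- x')) !subrr !add0r !scalerA divfK //.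
  move=> /(mE t _ t0 (le_trans tu u1)) ->.
  by rewrite ler_piMl.
have slope_right t : 0 <= t -> t < 1 -> exists w s e, [/\ weyl w, w *m d = s *: d',
    0 <= s, 0 < e & forall u, 0 <= u -> u < e -> t + u <= 1 -> m (t + u) = m t + u * s].
  move=> t0 t1.
  have inB u : 0 < u -> u < 1 - t -> B (f (x + t *: d + u *: d)).
    move=> u0 u1; rewrite -addrA -scalerDl.
    have [_ _ ->] : [/\ 0 <= m (t + u), m (t + u) <= 1
      & f (x + (t + u) *: d) = f' (x' + m (t + u) *: d')] by apply: hm; lra.
    exact: (isom_in hM _ aB f'B).
  have t10 : 0 < 1 - t by lra.
  have [w [v [e [ww e0 he]]]] :=
    local_chart aA aB fA f'B dn (or_introl xy) t10 inB.
  have base : aff w v (x + t *: d) = x' + m t *: d'.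
    apply: (isom_inj hM aB f'B).
    have [_ _ <-] := hm t t0 (ltW t1).
    by have := he 0 (lexx 0) e0; rewrite scale0r addr0.
  have val u : 0 <= u -> u < e -> t + u <= 1 ->
      m (t + u) *: d' = m t *: d' + u *: (w *m d).
    move=> u0 ue tu1; have := he u u0 ue; rewrite -addrA -scalerDl.
    have [_ _ ->] : [/\ 0 <= m (t + u), m (t + u) <= 1
      & f (x + (t + u) *: d) = f' (x' + m (t + u) *: d')] by apply: hm; lra.
    move=> /(isom_inj hM aB f'B) E; apply: (addrI x'); rewrite E.
    by rewrite addrA -base /aff scalerDl addrA mulmxDr -scalemxAr addrAC.
  pose u0 := Num.min (e / 2) (1 - t).
  have u00 : 0 < u0 by rewrite lt_min; lra.
  have u0e : u0 < e by rewrite gt_min; lra.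
  have tu0 : t + u0 <= 1.
    by rewrite addrC -lerBrDr ge_min lexx orbT.
  have wd : w *m d = ((m (t + u0) - m t) / u0) *: d'.
    rewrite mulrC -scalerA scalerBl val //; last exact: ltW.
    by rewrite addrAC subrr add0r scalerA mulVf ?scale1r // gt_eqF.
  exists w, ((m (t + u0) - m t) / u0), e; split=> //.
    apply: divr_ge0; last exact: ltW.
    by rewrite subr_ge0; apply: m_mono; lra.
  by move=> u h1 h2 h3; apply: scale_inj; rewrite val // wd scalerA -scalerDl.
(* The same with the direction [- d], which (MA2) admits since its opposite lies in the Tits
   cone. *)
have slope_left t : 0 < t -> t <= 1 -> exists w s e, [/\ weyl w, w *m d = s *: d',
    0 <= s, 0 < e & forall u, 0 <= u -> u < e -> u <= t -> m (t - u) = m t - u * s].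
  move=> t0 t1.
  have inB u : 0 < u -> u < t -> B (f (x + t *: d + u *: - d)).
    move=> u0 u1; rewrite -addrA scalerN -scalerBl.
    have [_ _ ->] : [/\ 0 <= m (t - u), m (t - u) <= 1
      & f (x + (t - u) *: d) = f' (x' + m (t - u) *: d')] by apply: hm; lra.
    exact: (isom_in hM _ aB f'B).
  have dn' : - d != 0 by rewrite oppr_eq0.
  have td' : tits (- d) \/ tits (- - d) by right; rewrite opprK.
  have [w [v [e [ww e0 he]]]] := local_chart aA aB fA f'B dn' td' t0 inB.
  have base : aff w v (x + t *: d) = x' + m t *: d'.
    apply: (isom_inj hM aB f'B).
    have [_ _ <-] := hm t (ltW t0) t1.
    by have := he 0 (lexx 0) e0; rewrite scale0r addr0.
  have val u : 0 <= u -> u < e -> u <= t ->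
      m (t - u) *: d' = m t *: d' - u *: (w *m d).
    move=> u0 ue ut; have := he u u0 ue; rewrite -addrA scalerN -scalerBl.
    have [_ _ ->] : [/\ 0 <= m (t - u), m (t - u) <= 1
      & f (x + (t - u) *: d) = f' (x' + m (t - u) *: d')] by apply: hm; lra.
    move=> /(isom_inj hM aB f'B) E; apply: (addrI x'); rewrite E.
    by rewrite addrA -base /aff scalerBl addrA mulmxBr -scalemxAr addrAC.
  pose u0 := Num.min (e / 2) t.
  have u00 : 0 < u0 by rewrite lt_min; lra.
  have u0e : u0 < e by rewrite gt_min; lra.
  have u0t : u0 <= t by rewrite ge_min lexx orbT.
  have wd : w *m d = ((m t - m (t - u0)) / u0) *: d'.
    rewrite mulrC -scalerA scalerBl val //; last exact: ltW.
    by rewrite opprB addrCA subrr addr0 scalerA mulVf ?scale1r // gt_eqF.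
  exists w, ((m t - m (t - u0)) / u0), e; split=> //.
    apply: divr_ge0; last exact: ltW.
    by rewrite subr_ge0; apply: m_mono; lra.
  by move=> u h1 h2 h3; apply: scale_inj; rewrite val // wd scalerA -scalerBl.
have [w0 [s0 [e0 [ww0 wd0 s00 e00 _]]]] := slope_right 0 (lexx 0) ltr01.
have m0 : m 0 = 0 by apply: mE => //; rewrite ?ler01 // !scale0r !addr0.
have m1 : m 1 = 1 by apply: mE => //; rewrite ?ler01 // !scale1r !subrKC.
have lin : forall t, 0 <= t -> t <= 1 -> m t = t * s0.
  apply: real_induction; first by rewrite m0 mul0r.
    move=> t t0 t1 mt; have [w [s [e [ww wd s0' ep he]]]] := slope_right t t0 t1.
    have es := tits_slope_unique ww ww0 xy dn s0' s00 wd wd0.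
    exists e => // t' tt' t'e t'1.
    have tE : t + (t' - t) = t' by ring.
    have := he (t' - t); rewrite tE mt es => -> //; [by ring|lra|lra].
  move=> t t0 t1 mt; have [w [s [e [ww wd s0' ep he]]]] := slope_left t t0 t1.
  have es := tits_slope_unique ww ww0 xy dn s0' s00 wd wd0.
  pose u := Num.min (e / 2) t.
  have u0 : 0 < u by rewrite lt_min; lra.
  have ut : u <= t by rewrite ge_min lexx orbT.
  have ue : u < e by rewrite gt_min; lra.
  have := he u (ltW u0) ue ut; rewrite mt ?subr_ge0 //; last by lra.
  by rewrite es; lra.
have s01 : s0 = 1 by have := lin 1 ler01 (lexx 1); rewrite m1 mul1r.
exists w0 => //; split; first by rewrite wd0 s01 scale1r.
by move=> t t0 t1; have [_ _ ->] := hm t t0 t1; rewrite lin // s01 mulr1.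
Qed.

End Affine.

End Segments.

(** * Adjacent sector-germs *)

Section Adjacent.
Context (R : realType) (D : root_datum) (g : km_algebra R[i] (@rd_cartan D)).
Context (T : Type) (M : apartment_system R D T) (hM : is_masure g M).
Local Notation I := (rd_idx D).
Local Notation V := (model R D).
Local Notation al := (@sroot R D).
Local Notation r := (@refl R D).
Local Notation mat := 'M[R]_(rd_rank D).
Local Notation sector := (@germ R D finset.set0).
Local Notation C := (@fund_face R D finset.set0).
Local Notation chart := (@chart R D T M).
Local Notation panel i := (@cface R D [set i]%SET).

(** For [p] far out in the panel, every simple root other than [al i] is nonnegative on [v + p] and
    on [r i *m v + p]. According to the sign of [al i] at [v], one of these is dominant and in the
    orbit of the chamber vector [z + p], hence equal to it. *)
Lemma panel_slope i (z v : V) : C z ->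
  (forall p, panel i p -> exists2 w : mat, weyl w & v + p = w *m (z + p)) ->
  v = z \/ v = r i *m z.
Proof.
move=> cz h; have [p0 hp0] := fund_face_nonempty R [set i]%SET.
have p0i : ev (al i) p0 = 0 by have := hp0 i; rewrite finset.in_set1 eqxx.
have p0j j : j != i -> 0 < ev (al j) p0.
  by move=> ji; have := hp0 j; rewrite finset.in_set1 (negbTE ji).
have [n n0 hn] := finite_bound (fun j =>
  (`|ev (al j) v| + `|ev (al j) (r i *m v)|) / ev (al j) p0).
have np : panel i (n *: p0).
  by apply: cface_scale; [exact: ltW | exact: fund_face_cface].
have bound j : j != i -> 0 <= ev (al j) (v + n *: p0) /\
    0 <= ev (al j) (r i *m v + n *: p0).
  move=> ji; rewrite !evDr evZr; have := hn j; rewrite ler_pdivrMr ?p0j //.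
  have := ler_norm (- ev (al j) v); have := ler_norm (- ev (al j) (r i *m v)).
  rewrite !normrN; have := normr_ge0 (ev (al j) v).
  by have := normr_ge0 (ev (al j) (r i *m v)); split; lra.
have rnp : r i *m (n *: p0) = n *: p0 by rewrite refl_fix // evZr p0i mulr0.
have cznp : @fund_chamber R D (z + n *: p0).
  rewrite -fund_face0; apply: fund_face_add => //; rewrite cface0.
  exact: cface_dom np.
have [w ww e] := h _ np; case: (lerP 0 (ev (al i) v)) => vi.
  have /(chamber_face_weyl ww cznp) w1 : dom (w *m (z + n *: p0)).
    move=> j; rewrite -e; have [->|/bound[] //] := eqVneq j i.
    by rewrite evDr evZr p0i mulr0 addr0.
  by left; apply: (addIr (n *: p0)); rewrite e w1 mul1mx.
have rw := weylM (weyl_refl R i) ww.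
have E : r i *m w *m (z + n *: p0) = r i *m v + n *: p0.
  by rewrite -mulmxA -e mulmxDr rnp.
have /(chamber_face_weyl rw cznp) w1 : dom (r i *m w *m (z + n *: p0)).
  move=> j; rewrite E; have [->|/bound[] //] := eqVneq j i.
  by rewrite evDr ev_refl_same evZr p0i mulr0 addr0; lra.
move: E; rewrite w1 mul1mx => /addIr ->.
by right; rewrite mulmxA reflK mul1mx.
Qed.

Context (s : set_system T) (A0 : set T) (psi : V -> T) (i : I).
Context (cpsi : chart s A0 psi).
Local Notation q := (fmap (psi \o aff (r i) 0) sector).
Local Notation panel_i := (panel i).

Lemma chart_adjacent : chart q A0 (psi \o aff (r i) 0).
Proof.
have [aA0 psiA0 _] := cpsi; split=> //.
exact: (isom_comp hM aA0 psiA0 (weyl_refl R i) (coroot_lattice0 R D)).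
Qed.

Lemma tits_chamber (z : V) : C z -> tits_cone z.
Proof. by move=> cz; apply: tits_dom; rewrite -cface0; exact: fund_face_cface. Qed.

Lemma chamber_panel (z p : V) : C z -> panel_i p -> C (z + p).
Proof.
by move=> cz hp; apply: fund_face_add => //; rewrite cface0; exact: cface_dom hp.
Qed.

Section Chart.
Context (A : set T) (f : V -> T) (cf : chart s A f).

(* In the notation of the paper, [f y +_s p = f y +_q p]. *)
Definition panel_parallel (y : V) : Prop := exists B f' y',
  [/\ chart q B f', f y = f' y' & forall p, panel_i p -> f (y + p) = f' (y' + p)].

Lemma panel_parallel_any y B f' y' : panel_parallel y -> chart q B f' ->
  f y = f' y' -> forall p, panel_i p -> f (y + p) = f' (y' + p).
Proof.
move=> [B1 [f1 [y1 [c1 e1 h1]]]] c' e' p hp; rewrite (h1 p hp).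
by apply: (chart_add hM c1 c' _ (cface_dom hp)); rewrite -e1 e'.
Qed.

(** From a common point on, [chart_add] reads everything in [A0], where the two charts differ by
    [r i], which fixes the panel directions. *)
Lemma panel_parallel_deep : exists y0, forall c, dom c -> panel_parallel (y0 + c).
Proof.
have [y0 [y1 e]] := chart_meet hM cf cpsi; exists y0 => c dc.
exists A0, (psi \o aff (r i) 0), (r i *m (y1 + c)); split.
- exact: chart_adjacent.
- by rewrite /= /aff addr0 mulmxA reflK mul1mx; exact: (chart_add hM cf cpsi e dc).
- move=> p hp; rewrite /= /aff addr0 mulmxDr mulmxA reflK mul1mx.
  have -> : r i *m p = p.
    by apply: refl_fix; have := hp i; rewrite finset.in_set1 eqxx.
  rewrite -!addrA; apply: (chart_add hM cf cpsi e) => j.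
  by rewrite evDr addr_ge0 //; exact: cface_dom hp j.
Qed.

(** (MA3) puts [q] and the face at [y] into one apartment; [local_chart] then describes a short
    segment from [y] in direction [z]. *)
Lemma chart_direction y (z : V) (Fv : set V) : vface Fv -> z != 0 ->
  tits_cone z \/ tits_cone (- z) -> (forall t, 0 < t -> Fv (t *: z)) ->
  exists B f' y' (w : mat) e, [/\ chart q B f', f y = f' y', weyl w, 0 < e &
    forall t, 0 <= t -> t < e -> f (y + t *: z) = f' (y' + t *: (w *m z))].
Proof.
move=> vF z0 tz Fz; have [aA fA _] := cf.
have [B [f' [cB FB]]] := chart_face hM y chart_adjacent aA fA vF.
have [e e0 he] := face_at_cone FB; have nz : 0 < `|z| by rewrite normr_gt0.
have ez : 0 < e / `|z| by rewrite divr_gt0.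
have inB t : 0 < t -> t < e / `|z| -> B (f (y + t *: z)).
  move=> t0; rewrite ltr_pdivlMr // => tz'; apply: he; first exact: Fz.
  by rewrite normrZ gtr0_norm.
have [aB f'B _] := cB.
have [w [v [e' [ww e'0 E]]]] := local_chart hM aA aB fA f'B z0 tz ez inB.
exists B, f', (aff w v y), w, e'; split=> //.
  by have := E 0 (lexx 0) e'0; rewrite scale0r addr0.
move=> t t0 te; rewrite E //; congr f'.
by rewrite /aff mulmxDr -scalemxAr addrAC.
Qed.

Lemma chamber_cone_faces (z : V) : C z -> z != 0 ->
  (forall t, 0 < t -> C (t *: z)) /\
  (forall t, 0 < t -> [set - v | v in C] (t *: - z)).
Proof.
move=> cz z0; split=> t t0; first exact: fund_face_scale.
by exists (t *: z); [exact: fund_face_scale | rewrite scalerN].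
Qed.

(** The segments from [y - t *: z] to [y + p] have their ends in both apartments, so both share them
    affinely. Their directions determine [v] by [panel_slope], and their interior points give the
    parallelism below [y]. *)
Lemma step_down y (z : V) : C z -> z != 0 -> panel_parallel y ->
  exists B f' y' v e, [/\ chart q B f', v = z \/ v = r i *m z, 0 < e &
    forall t, 0 <= t -> t < e ->
      f (y - t *: z) = f' (y' - t *: v) /\ panel_parallel (y - t *: z)].
Proof.
move=> cz z0 py; have [_ Fz] := chamber_cone_faces cz z0.
have z0' : - z != 0 by rewrite oppr_eq0.
have tz : tits_cone (- z) \/ tits_cone (- - z).
  by right; rewrite opprK; exact: tits_chamber.
have [B [f' [y' [w [e [cB fy ww e0 he]]]]]] :=
  chart_direction y (vface_opp_chamber R D) z0' tz Fz.
have {}he t : 0 <= t -> t < e -> f (y - t *: z) = f' (y' - t *: (w *m z)).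
  by move=> t0 te; have := he t t0 te; rewrite mulmxN !scalerN.
have par := panel_parallel_any py cB fy.
have [aA fA _] := cf; have [aB f'B _] := cB.
have seg t p : 0 < t -> t < e -> panel_i p ->
    exists2 w' : mat, weyl w' & t *: (w *m z) + p = w' *m (t *: z + p) /\
    forall u, 0 <= u -> u <= 1 ->
      f (y - t *: z + u *: (t *: z + p)) = f' (y' - t *: (w *m z) + u *: (t *: (w *m z) + p)).
  move=> t0 te hp; have E a b : a + p - (a - b) = b + p :> V.
    by apply/matrixP => k l; rewrite !mxE; ring.
  have tt : tits_cone (y + p - (y - t *: z)).
    by rewrite E; apply/tits_chamber/chamber_panel => //; exact: fund_face_scale.
  have := segment_affine hM aA aB fA f'B (he t (ltW t0) te) (par p hp) tt.
  by rewrite !E.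
exists B, f', y', (w *m z), e; split=> //.
  pose t := e / 2; have t0 : 0 < t by rewrite divr_gt0.
  have te : t < e by rewrite /t; lra.
  have ctz : C (t *: z) by exact: fund_face_scale.
  have [|E|E] := panel_slope (i := i) (v := t *: (w *m z)) ctz.
  - by move=> p hp; have [w' ww' [E _]] := seg t p t0 te hp; exists w'.
  - by left; apply: (scalerI (negbT (gt_eqF t0))).
  - by right; apply: (scalerI (negbT (gt_eqF t0))); rewrite E -scalemxAr.
move=> t t0 te; split; first exact: he.
exists B, f', (y' - t *: (w *m z)); split=> //; first exact: he.
move=> p hp; have [->|tn] := eqVneq t 0.
  by rewrite !scale0r !subr0; exact: par.
have tp : 0 < t by rewrite lt_neqAle eq_sym tn.
(* The point [y - t *: z + p] has parameter [u] on the segment from [y - (t / (1 - u)) *: z] to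
   [y + u^-1 *: p]. Taking half of [1 - t / e] keeps [t / (1 - u)] below [e]. *)
pose u := (1 - t / e) / 2; have te1 : t / e < 1 by rewrite ltr_pdivrMr // mul1r.
have u0 : 0 < u by rewrite /u; lra.
have te0 : 0 < t / e by rewrite divr_gt0.
have u1 : u < 1 by rewrite /u; lra.
have u10 : 0 < 1 - u by lra.
have t'0 : 0 < t / (1 - u) by rewrite divr_gt0.
have t'e : t / (1 - u) < e.
  have : t / e < 1 - u by rewrite /u; lra.
  by rewrite !ltr_pdivrMr // mulrC.
have hp' : panel_i (u^-1 *: p) by apply: cface_scale => //; rewrite invr_ge0 ltW.
have [_ _ [_ /(_ u (ltW u0) (ltW u1))]] := seg _ _ t'0 t'e hp'.
have E (a b : V) : a - (t / (1 - u)) *: b + u *: ((t / (1 - u)) *: b + u^-1 *: p)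
    = a - t *: b + p.
  by apply/matrixP => k l; rewrite !mxE; field; rewrite !gt_eqF.
by rewrite !E.
Qed.

(** The apartment [B] contains the points [y + p + t *: z] for small positive [t], and [local_chart]
    reaches their limit [y + p]. *)
Lemma step_limit y (z : V) e : C z -> z != 0 -> 0 < e ->
  (forall t, 0 < t -> t < e -> panel_parallel (y + t *: z)) ->
  panel_parallel y /\
  exists B f' y' v e', [/\ chart q B f', v = z \/ v = r i *m z, 0 < e' &
    forall t, 0 <= t -> t < e' -> f (y + t *: z) = f' (y' + t *: v)].
Proof.
move=> cz z0 e0 par; have [Fz _] := chamber_cone_faces cz z0.
have tz : tits_cone z \/ tits_cone (- z) by left; exact: tits_chamber.
have [B [f' [y' [w [e1 [cB fy ww e10 he]]]]]] :=
  chart_direction y (vface_fund R finset.set0) z0 tz Fz.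
have [aA fA _] := cf; have [aB f'B _] := cB.
pose e2 := Num.min e e1; have e20 : 0 < e2 by rewrite lt_min e0.
have par' t p : 0 < t -> t < e2 -> panel_i p ->
    f (y + t *: z + p) = f' (y' + t *: (w *m z) + p).
  rewrite lt_min => t0 /andP[te te1].
  exact: (panel_parallel_any (par t t0 te) cB (he t (ltW t0) te1)).
have pary p : panel_i p -> f (y + p) = f' (y' + p).
  move=> hp; have inB t : 0 < t -> t < e2 -> B (f (y + p + t *: z)).
    by move=> t0 te; rewrite addrAC par' //; exact: (isom_in hM _ aB f'B).
  have [w2 [v2 [e3 [ww2 e30 E]]]] := local_chart hM aA aB fA f'B z0 tz e20 inB.
  have := E 0 (lexx 0) e30; rewrite scale0r addr0 => ->; congr f'.
  have lin t : 0 < t -> t < Num.min e2 e3 ->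
      aff w2 v2 (y + p) + t *: (w2 *m z) = y' + p + t *: (w *m z).
    rewrite lt_min => t0 /andP[te te3]; apply: (isom_inj hM aB f'B).
    have := E t (ltW t0) te3; rewrite addrAC par' // => h.
    rewrite (addrAC y') h (addrAC y) /aff (mulmxDr w2 (y + p)) -scalemxAr.
    by rewrite (addrAC (w2 *m (y + p))).
  have m0 : 0 < Num.min e2 e3 by rewrite lt_min e20.
  (* Two affine functions of [t] that agree at two points have the same constant term. *)
  move: (Num.min e2 e3) m0 lin => m m0 lin.
  have l1 : aff w2 v2 (y + p) + (m / 2) *: (w2 *m z) = y' + p + (m / 2) *: (w *m z).
    by apply: lin; lra.
  have l2 : aff w2 v2 (y + p) + (m / 4) *: (w2 *m z) = y' + p + (m / 4) *: (w *m z).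
    by apply: lin; lra.
  move: l1 l2; move: (aff _ _ _) (y' + p) (w2 *m z) (w *m z) => a b c d l1 l2.
  apply/matrixP => k l; move/matrixP/(_ k l): l1; move/matrixP/(_ k l): l2.
  by rewrite !mxE; lra.
split; first by exists B, f', y'; split.
exists B, f', y', (w *m z), e1; split=> //.
pose t := e2 / 2; have t0 : 0 < t by rewrite divr_gt0.
have te : t < e2 by rewrite /t; lra.
have ctz : C (t *: z) by exact: fund_face_scale.
have [|E|E] := panel_slope (i := i) (v := t *: (w *m z)) ctz.
- move=> p hp; have E a b : a + b + p - a = b + p :> V.
    by apply/matrixP => k l; rewrite !mxE; ring.
  have tt : tits_cone (y + t *: z + p - y).
    by rewrite E; apply/tits_chamber/chamber_panel.
  have [w' ww' [+ _]] := segment_affine hM aA aB fA f'B fy (par' t p t0 te hp) tt.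
  by rewrite !E => h; exists w'.
- by left; apply: (scalerI (negbT (gt_eqF t0))).
- by right; apply: (scalerI (negbT (gt_eqF t0))); rewrite E -scalemxAr.
Qed.

(** Real induction along the line from [y + z], deep in the sector, down to [y]: [step_down]
    advances and [step_limit] passes to the limit. *)
Lemma panel_parallel_everywhere y : panel_parallel y.
Proof.
have [y0 deep] := panel_parallel_deep.
have [z hz] := dominating (fun j : 'I_2 => nth 0 [:: 0; y0 - y] j).
have cz : C z by rewrite fund_face0 -[z]subr0; exact: (hz ord0).
have [zz|z0] := eqVneq z 0.
  have -> : y = y0 + (y - y0) by rewrite subrKC.
  apply: deep => j; apply/ltW; have := hz (inord 1) j.
  by rewrite inordK //= zz sub0r opprB.
suff : forall t, 0 <= t -> t <= 1 -> panel_parallel (y + z - t *: z).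
  by move=> /(_ 1 ler01 (lexx 1)); rewrite scale1r addrK.
apply: real_induction.
- rewrite scale0r subr0; have -> : y + z = y0 + (z - (y0 - y)).
    by apply/matrixP => k l; rewrite !mxE; ring.
  by apply: deep => j; apply/ltW; have := hz (inord 1) j; rewrite inordK.
- move=> t t0 t1 /(step_down cz z0)[B [f' [y' [v [e [_ _ e0 he]]]]]].
  exists e => // t' tt' t'e _; have [] := he (t' - t); [by lra|by lra|move=> _].
  have -> // : y + z - t *: z - (t' - t) *: z = y + z - t' *: z.
  by apply/matrixP => k l; rewrite !mxE; ring.
- move=> t t0 t1 IH.
  have [] // := step_limit (y := y + z - t *: z) cz z0 t0.
  move=> u u0 ut; have -> : y + z - t *: z + u *: z = y + z - (t - u) *: z.
    by apply/matrixP => k l; rewrite !mxE; ring.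
  by apply: IH; lra.
Qed.

End Chart.

Context (N : V -> R) (hN : is_norm N).
Local Notation dist s := (dist M false (N, s)).

(** On either side of every point of the path [y + t *: z], a chart centred at [q] sees the velocity
    [z] or [r i *m z]. The local estimates add up by the triangle inequality and real induction. *)
Lemma dist_chamber_step : exists2 K : R, 0 < K & forall A f y z, chart s A f -> C z ->
  dist q (f y) (f (y + z)) <= K * `|z|.
Proof.
have [K K0 hK] := dist_chart_le hM hN.
have [K2 K20 hK2] : exists2 K2 : R, 0 < K2 &
    forall z v : V, v = z \/ v = r i *m z -> `|v| <= K2 * `|z|.
  have [k k0 hk] := ev_bounded (al i).
  exists (1 + k * `|scoroot R i|); first by rewrite ltr_wpDr // mulr_ge0 // ltW.
  move=> z _ [->|->]; rewrite mulrDl mul1r.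
    by rewrite lerDl !mulr_ge0 // ltW.
  rewrite refl_mul (le_trans (ler_normB _ _)) // lerD2l normrZ.
  by rewrite mulrAC ler_wpM2r.
have cq := chart_adjacent.
exists (K * K2) => [|A f y z cf cz]; first exact: mulr_gt0.
have [->|z0] := eqVneq z 0.
  rewrite normr0 mulr0 addr0.
  have [B [f' [y' [c' <-]]]] := chart_cover hM (f y) cq.
  by have := hK _ _ _ y' y' c'; rewrite subrr normr0 mulr0.
have Kz : 0 <= K * K2 * `|z| by rewrite !mulr_ge0 // ltW.
have step B f' (a : V) v t u : chart q B f' -> v = z \/ v = r i *m z -> t <= u ->
    dist q (f' (a + t *: v)) (f' (a + u *: v)) <= (u - t) * (K * K2 * `|z|).
  move=> c' hv tu; rewrite (le_trans (hK _ _ _ _ _ c')) //.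
  rewrite opprD addrACA subrr add0r -scalerBl normrZ distrC ger0_norm ?subr_ge0 //.
  rewrite mulrCA ler_wpM2l ?subr_ge0 // -mulrA ler_wpM2l //; first exact: ltW.
  exact: hK2.
suff : forall t, 0 <= t -> t <= 1 ->
    dist q (f y) (f (y + t *: z)) <= t * (K * K2 * `|z|).
  by move=> /(_ 1 ler01 (lexx 1)); rewrite scale1r mul1r.
apply: real_induction.
- rewrite scale0r mul0r addr0; have [B [f' [y' [c' <-]]]] := chart_cover hM (f y) cq.
  by have := hK _ _ _ y' y' c'; rewrite subrr normr0 mulr0.
- move=> t t0 t1 IH.
  have [_ [B [f' [y' [v [e [c' hv e0 he]]]]]]] :=
    step_limit cf (y := y + t *: z) cz z0 ltr01
      (fun u _ _ => panel_parallel_everywhere cf _).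
  exists e => // t' tt' t'e t'1.
  rewrite (le_trans (dist_triangle hM hN _ (f (y + t *: z)) _ cq)) //.
  have E1 := he 0 (lexx 0) e0; have E2 : f (y + t' *: z) = f' (y' + (t' - t) *: v).
    by rewrite -he; [rewrite -addrA -scalerDl subrKC|lra|lra].
  rewrite scale0r addr0 in E1; rewrite E2 {2}E1.
  have := step B f' y' v 0 (t' - t) c' hv; rewrite subr_ge0 subr0 => /(_ (ltW tt')).
  by move: IH; lra.
(* At a limit parameter [t] the estimate at [t - u] is extended by the chart that [step_down] gives
   below [y + t *: z]. *)
- move=> t t0 t1 IH.
  have [B [f' [y' [v [e [c' hv e0 he]]]]]] :=
    step_down cf cz z0 (panel_parallel_everywhere cf (y + t *: z)).
  pose u := Num.min (e / 2) t.
  have u0 : 0 < u by rewrite lt_min; lra.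
  have ut : u <= t by rewrite ge_min lexx orbT.
  have ue : u < e by rewrite gt_min; lra.
  rewrite (le_trans (dist_triangle hM hN _ (f (y + (t - u) *: z)) _ cq)) //.
  have [E1 _] := he 0 (lexx 0) e0; have [E2 _] := he u (ltW u0) ue.
  rewrite !scale0r !subr0 in E1; rewrite -addrA -scalerBl in E2.
  have := step B f' y' v (- u) 0 c' hv; rewrite oppr_le0 => /(_ (ltW u0)).
  rewrite scale0r addr0 scaleNr -E1 -E2; have := IH (t - u).
  rewrite subr_ge0 => /(_ ut); lra.
Qed.

(** Within one chart centred at [s], a displacement is a difference of two chamber vectors, each
    bounded by [dist_chamber_step]. In general, go from [x] to [x'] through the common point of an
    admissible pair for [s]. *)
Lemma dist_adjacent_le : exists2 K : R, 0 < K & forall x x',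
  dist q x x' <= K * dist s x x'.
Proof.
have [K1 K10 hK1] := dist_chamber_step; have cq := chart_adjacent.
have ND := norm_triangle hN; have NZ := norm_scale hN.
have [c c0 hc] := norm_equivalent ND NZ (norm_eq0 hN).
have [K2 K20 hK2] := small_dominant_decomposition hN.
have N0 := seminorm_ge0 ND NZ.
have [K3 K30 hK3] : exists2 K3 : R, 0 < K3 & forall A f x u, chart s A f ->
    dist q (f x) (f (x + u)) <= K3 * `|u|.
  exists (K1 * c * K2) => [|A f x u cf]; first by rewrite !mulr_gt0.
  have [->|u0] := eqVneq u 0.
    have [p hp] := fund_face_nonempty R (finset.set0 : {set I}).
    rewrite normr0 mulr0 addr0; apply/ler_addgt0Pr => e e0; rewrite add0r.
    have [B [f' [y' [c' <-]]]] := chart_cover hM (f x) cq.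
    have [K _ hK] := dist_chart_le hM hN.
    by have := hK _ _ _ y' y' c'; rewrite subrr normr0 mulr0; lra.
  have [a [b [ca cb e h]]] := hK2 u u0.
  rewrite -fund_face0 in ca cb.
  have E : x + u + b = x + a by rewrite e -addrA subrK.
  rewrite (le_trans (dist_triangle hM hN _ (f (x + a)) _ cq)) //.
  have h1 := hK1 _ _ x a cf ca; have h2 := hK1 _ _ (x + u) b cf cb.
  rewrite E (dist_sym hM hN _ _ cq) in h2.
  have h3 : K1 * `|a| <= K1 * (c * N a) by rewrite ler_pM2l.
  have h4 : K1 * `|b| <= K1 * (c * N b) by rewrite ler_pM2l.
  have h5 : K1 * c * (N a + N b) <= K1 * c * (K2 * `|u|).
    by rewrite ler_pM2l // mulr_gt0.
  by lra.
exists (K3 * c) => [|x x']; first by rewrite mulr_gt0.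
have Kc : 0 < K3 * c by rewrite mulr_gt0.
suff key p : U_pairs M false s x x' p ->
    (K3 * c)^-1 * dist q x x' <= N p.1 + N p.2.
  by rewrite -ler_pdivrMl //; exact: (dist_glb hM cpsi key).
move=> /(U_pairsP hM)[d1 d2 [A1 [f1 [y1 [A2 [f2 [y2 [c1 c2 <- <- e12]]]]]]]].
rewrite ler_pdivrMl //.
rewrite (le_trans (dist_triangle hM hN _ (f1 (y1 + p.1)) _ cq)) //.
have h1 := hK3 _ _ y1 p.1 c1; have h2 := hK3 _ _ y2 p.2 c2.
rewrite -e12 (dist_sym hM hN _ _ cq) in h2.
have h3 : K3 * `|p.1| <= K3 * (c * N p.1) by rewrite ler_pM2l.
have h4 : K3 * `|p.2| <= K3 * (c * N p.2) by rewrite ler_pM2l.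
by lra.
Qed.

End Adjacent.

(** * Comparison of all positive sector-germs and the induced topology *)

Section Equivalence.
Context (R : realType) (D : root_datum) (g : km_algebra R[i] (@rd_cartan D)).
Context (T : Type) (M : apartment_system R D T) (hM : is_masure g M).
Local Notation V := (model R D).
Local Notation mat := 'M[R]_(rd_rank D).
Local Notation sector := (@germ R D finset.set0).
Local Notation chart := (@chart R D T M).
Context (N : V -> R) (hN : is_norm N).
Local Notation dist s := (dist M false (N, s)).

Lemma fmap_translate (f : V -> T) (w : mat) (v : V) : weyl w ->
  fmap (f \o aff w v) sector = fmap (f \o aff w 0) sector.
Proof.
move=> ww; have [w' _ [_ ww1]] := weyl_inverse ww.
have E x : aff w v x = aff w 0 (x + w' *m v).
  by rewrite /aff mulmxDr mulmxA ww1 mul1mx addr0.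
apply/seteqP; split=> P /= h.
  by apply/(germ_translate (w' *m v)); apply: (germ_sub h) => x /=; rewrite E.
move/(germ_translate (w' *m v)): h => h.
by apply: (germ_sub h) => x /=; rewrite E.
Qed.

(** The chart absorbs the Weyl element of the chamber, and translations do not change germs, so the
    base point disappears. *)
Lemma sector_germ_chart s : sector_germ M false s -> exists A f, chart s A f.
Proof.
move=> [A aA [f [_ [fA [x [_ [[w ww ->] ->]]] ->]]]].
have [w' _ [w'w ww1]] := weyl_inverse ww.
exists A, (f \o aff w 0); split=> //.
  exact: (isom_comp hM aA fA ww (coroot_lattice0 R D)).
rewrite -(fmap_translate f x ww); apply/seteqP; split=> P /=.
  move=> /germP[u hu h]; rewrite fund_face0 in hu.
  exists (w *m u).
    by apply: subset_closure; exists u => //; rewrite /sgn expr0 scale1r.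
  move=> _ [_ [c hc <-] <-] /=; have /h : cface finset.set0 c.
    by rewrite cface0 => i; exact/ltW/hc.
  rewrite /= /aff mulmxDr; set y := _ + x; set z := _ + _ + _.
  suff -> : y = z by [].
  by rewrite /y /z /sgn expr0 scale1r addrC addrA.
move=> [u _ h]; have [u1 hu1 hu1u] := dominant_shift (- (w' *m u)).
apply/germP; exists u1; first by rewrite fund_face0.
rewrite cface0 => p dp /=; apply: h.
exists (w *m (u1 - w' *m u + p)).
  exists (u1 - w' *m u + p); last by rewrite /sgn expr0 scale1r.
  by move=> i; rewrite evDr ltr_wpDr //; exact: hu1u.
rewrite /aff !mulmxDr mulmxN mulmxA ww1 mul1mx.
by apply/matrixP => k l; rewrite !mxE; ring.
Qed.

(** A word is a gallery: each letter crosses one panel and contributes one constant from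
    [dist_adjacent_le]. *)
Lemma dist_word_le A psi l : apt M A -> isomw M A psi ->
  exists2 K : R, 0 < K & forall x x',
    dist (fmap (psi \o aff (word R l) 0) sector) x x' <= K * dist (fmap psi sector) x x'.
Proof.
move=> aA; elim: l psi => [|i l IH] psi psiA.
  exists 1 => // x x'; rewrite mul1r.
  suff -> : psi \o aff (word R [::]) 0 = psi by [].
  by apply/funext => y; rewrite /= /aff mul1mx addr0.
have c0 : chart (fmap psi sector) A psi by split.
have [_ riA _] := chart_adjacent hM i c0.
have [K1 K10 h1] := dist_adjacent_le hM i c0 hN.
have [K2 K20 h2] := IH _ riA.
exists (K2 * K1) => [|x x']; first exact: mulr_gt0.
have -> : psi \o aff (word R (i :: l)) 0 = psi \o aff (refl R i) 0 \o aff (word R l) 0.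
  by apply/funext => y; rewrite /= aff_comp mulmx0 addr0.
by rewrite (le_trans (h2 x x')) // -mulrA ler_pM2l.
Qed.

(** (MA3) puts both germs into one apartment. Two charts centred at them differ by an affine Weyl
    element, whose linear part is a word and whose translation part preserves the germ. *)
Lemma dist_equivalent s s' A A' f f' : chart s A f -> chart s' A' f' ->
  exists2 K : R, 0 < K & forall x x', dist s' x x' <= K * dist s x x'.
Proof.
move=> cf cf'; have [aA fA es] := cf; have [aA' f'A' es'] := cf'.
have [B [aB sB s'B]] :=
  masure_MA3 hM (sector_splayed g aA fA) (sector_solid g aA' f'A').
rewrite es in sB; rewrite es' in s'B.
have [psi [_ psiB <-]] := chart_transfer hM cf aB sB.
have [psi' [_ psi'B <-]] := chart_transfer hM cf' aB s'B.
have [w [v [ww _ ->]]] := isom_diff hM aB psiB psi'B.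
rewrite fmap_translate //; have [l ->] := ww.
exact: dist_word_le aB psiB.
Qed.

(** The germ [s] is compared with the germ at which [f] itself is centred; on [A] the distance of
    the latter is equivalent to a norm. *)
Lemma induced_topology_chart s A0 f0 A f : chart s A0 f0 -> apt M A -> isomw M A f ->
  (exists2 K : R, 0 < K & forall x y, dist s (f x) (f y) <= K * `|x - y|) /\
  (exists2 K : R, 0 < K & forall x y, `|x - y| <= K * dist s (f x) (f y)).
Proof.
move=> c0 aA fA; have cf : chart (fmap f sector) A f by split.
have [K1 K10 h1] := dist_equivalent cf c0.
have [K2 K20 h2] := dist_equivalent c0 cf.
have [K3 K30 h3] := dist_chart_le hM hN.
have [c cp hc] := norm_equivalent (norm_triangle hN) (norm_scale hN) (norm_eq0 hN).
split.
  exists (K1 * K3) => [|x y]; first exact: mulr_gt0.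
  by rewrite (le_trans (h1 _ _)) // -mulrA ler_pM2l // (h3 _ _ _ _ _ cf).
exists (c * K2) => [|x y]; first exact: mulr_gt0.
rewrite (le_trans (hc _)) // -mulrA ler_pM2l // (le_trans _ (h2 _ _)) //.
exact: (dist_chart_ge hM hN _ _ cf).
Qed.

Lemma induced_topology_affine s A : sector_germ M false s -> apt M A ->
  induced_topology (metric_topology (dist s)) A = affine_topology M A.
Proof.
move=> /sector_germ_chart[A0 [f0 c0]] aA; apply/seteqP; split=> W.
  move=> [U oU ->]; split=> [x []//|f fA].
  have [[K K0 hK] _] := induced_topology_chart c0 aA fA.
  rewrite openE => x [_ /oU[r r0 hr]]; apply/nbhs_cVP.
  exists (r / K) => [|y]; first exact: divr_gt0.
  rewrite ltr_pdivlMr // mulrC => yr; split; first exact: (isom_in hM _ aA fA).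
  apply: hr; apply: le_lt_trans yr; rewrite (le_trans (hK _ _)) //.
  by rewrite opprD addrA subrr sub0r normrN.
move=> [WA oW]; have [f fA] := isom_ex hM aA.
have [[K K0 hK] [L L0 hL]] := induced_topology_chart c0 aA fA.
(* The union of the balls centred in [W] whose trace on [A] lies in [W]. *)
pose U := [set z | exists x r, [/\ W x, 0 < r,
  forall y, A y -> dist s x y < r -> W y & dist s x z < r]].
exists U.
  move=> z [x [r [Wx r0 hx xz]]]; exists (r - dist s x z); first by rewrite subr_gt0.
  move=> y zy; exists x, r; split=> //.
  by have := dist_triangle hM hN x z y c0; lra.
apply/seteqP; split=> [x Wx|x [Ax [y [r [_ _ h yx]]]]]; last exact: h.
split; first exact: WA.
have [a fa] := isom_surj hM aA fA (WA _ Wx); subst x.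
have := oW f fA; rewrite openE => /(_ a Wx) /nbhs_cVP[e e0 he].
exists (f a), (e / L); split=> //; first exact: divr_gt0.
  move=> y Ay; have [b <-] := isom_surj hM aA fA Ay.
  rewrite ltr_pdivlMr // mulrC => h; rewrite -[b](subrKC a); apply: he.
  by rewrite distrC; apply: le_lt_trans h.
rewrite (le_lt_trans (hK _ _)) // subrr normr0 mulr0; exact: divr_gt0.
Qed.

End Equivalence.

(* theta ranges over Theta_+ ; [false] is the sign + *)
Theorem corollary37 (R : realType) (D : root_datum)
    (g : km_algebra R[i] (@rd_cartan D))
    (T : Type) (M : apartment_system R D T)
    (hM : is_masure g M)
    (hthick : thick_locally_finite g M)
    (G : groupType) (act : G -> T -> T)
    (hact : strongly_transitive g M act)
    (A0 : set T) (f0 : model R D -> T)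
    (hA0 : apt M A0) (hf0 : isomw M A0 f0)
    (hstab : stabilizer_is_WY act f0)
    (theta : (model R D -> R) * set_system T) (htheta : Theta M false theta)
    (A : set T) (hA : apt M A) :
  induced_topology (metric_topology (dist M false theta)) A =
    affine_topology M A.
Proof.
case: theta htheta => N s [/= hN hs].
exact: (induced_topology_affine hM hN hs hA).
Qed.
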